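(* Let $\mathcal{A}$ and $\mathcal{B}$ be uniform algebras on compact Hausdorff spaces $X$ and $Y$ respectively. Let $T$ be a map from $\mathcal{A}^{-1}$ onto $\mathcal{B}^{-1}$ (not assumed to be linear, multiplicative, continuous or injective). Suppose that $$\|Tf\,Tg\|_{\infty(Y)}=\|fg\|_{\infty(X)}$$ holds for every $f,g\in\mathcal{A}^{-1}$. Then there exists a homeomorphism $\phi$ from $\mathrm{Ch}(\mathcal{B})$ onto $\mathrm{Ch}(\mathcal{A})$ such that $|Tf(y)|=|f(\phi(y))|$ holds for every $f\in\mathcal{A}^{-1}$ and $y\in\mathrm{Ch}(\mathcal{B})$.
   Context: A uniform algebra on a compact Hausdorff space $X$ is a uniformly closed subalgebra of $C(X)$ (complex-valued continuous functions) which contains the constants and separates the points of $X$. For a unital commutative Banach algebra $A$, $A^{-1}$ is the group of invertible elements of $A$. $\|g\|_{\infty(K)}$ is the supremum norm of $g$ on the set $K$. $\mathrm{Ch}(\mathcal{A})\subset X$ is the Choquet boundary of $\mathcal{A}$. *)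

(* Defs.v *)
From HB Require Import structures.
From mathcomp Require Import all_boot all_order all_algebra.
From mathcomp Require Import all_classical all_reals all_analysis.
From mathcomp Require Import complex.

Set Implicit Arguments.
Unset Strict Implicit.
Unset Printing Implicit Defensive.

Import Order.TTheory GRing.Theory Num.Theory.
Import numFieldNormedType.Exports.
Import Normc.

Local Open Scope classical_set_scope.
Local Open Scope complex_scope.
Local Open Scope ring_scope.

(* The topology, uniform structure and norm given by the modulus. *)
HB.instance Definition _ (R : rcfType) := NormedModule.copy R[i] R[i]^o.

Section UniformAlgebra.
Variables (R : realType) (X : topologicalType).
Local Notation C := R[i].

(* [normc] is the R-valued modulus; the supremum is 0 when K is empty. *)
Definition supnorm (K : set X) (f : X -> C) : R :=
  sup [set normc (f x) | x in K].

(* Closure under scalars follows from containing the constants. Uniform limits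
   of continuous functions are continuous, so being closed in {uniform X -> C}
   is the same as being closed in C(X). *)
Record uniform_algebra (A : set (X -> C)) : Prop := UniformAlgebra {
  ua_continuous : forall f, A f -> continuous f;
  ua_cst : forall c : C, A (cst c);
  ua_add : forall f g, A f -> A g -> A (f + g);
  ua_mul : forall f g, A f -> A g -> A (f * g);
  ua_closed : closed (A : set {uniform X -> C});
  ua_separates : forall x y : X, x <> y -> exists2 f, A f & f x <> f y }.

Definition invertibles (A : set (X -> C)) : set (X -> C) :=
  [set f | A f /\ exists2 g, A g & f * g = 1].

(* A functional on A is represented by a total function on X -> C of which only
   the values on A matter. A state is a linear functional F on A such that
   ||F|| = F(1) = 1; as ||1|| = 1 and F(1) = 1, the last field says ||F|| = 1. *)
Record is_state (A : set (X -> C)) (F : (X -> C) -> C) : Prop := IsState {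
  state_add : forall f g, A f -> A g -> F (f + g) = F f + F g;
  state_scale : forall (c : C) f, A f -> F (cst c * f) = c * F f;
  state_one : F 1 = 1;
  state_bound : forall f, A f -> normc (F f) <= supnorm setT f }.

(* F is an extreme point of the state space of A. *)
Definition extreme_state (A : set (X -> C)) (F : (X -> C) -> C) : Prop :=
  is_state A F /\
  forall (G H : (X -> C) -> C) (t : R),
    is_state A G -> is_state A H -> 0 < t < 1 ->
    {in A, forall f, F f = t%:C * G f + (1 - t)%:C * H f} ->
    {in A, G =1 F} /\ {in A, H =1 F}.

Definition Choquet_boundary (A : set (X -> C)) : set X :=
  [set x | extreme_state A (fun f => f x)].

End UniformAlgebra.

Definition homeomorphism_between (X Y : topologicalType)
    (P : set X) (Q : set Y) (phi : X -> Y) : Prop :=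
  [/\ set_bij P Q phi,
      {within P, continuous phi}
    & exists psi : Y -> X,
        {within Q, continuous psi} /\ {in P, cancel phi psi}].

(* Main.v *)
From HB Require Import structures.
Require Import Defs.
From mathcomp Require Import all_boot all_order all_algebra.
From mathcomp Require Import all_classical all_reals all_analysis.
From mathcomp Require Import complex ring lra.

Set Implicit Arguments.
Unset Strict Implicit.
Unset Printing Implicit Defensive.

Import Order.TTheory GRing.Theory Num.Theory.
Import numFieldNormedType.Exports.
Import Normc.

Local Open Scope classical_set_scope.
Local Open Scope complex_scope.
Local Open Scope ring_scope.

(** Invertible functions are compared through quotients. If [|h| <= c|f|] with [f]
and [h] invertible, multiply by the [g] for which [T g] is the inverse of [T f]:
the hypothesis on norms gives [|T h| <= c|T f|] on all of [Y]
([norm_correspondence_dominated]). So [T] transports domination of moduli, and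
a point [x] can be followed through functions that are nearly [1] in modulus at
[x] and small away from it.

The points with enough such functions are those for which [{x}] is a weak peak
set: invertible [f] exist with [|f| >= 1] on the set, [|f| <= 1 + e] everywhere
and [|f| <= e] off a given neighbourhood. These conditions only mention moduli,
are stable under products of functions, pass to intersections of chains by
compactness, and cut down to the part where a given [|g|] is maximal. Hence, by
Zorn's lemma, every nonempty weak peak set contains a weak peak point
([weak_peak_point_in]).

For a weak peak point [x] of [A], let [K] be the set of [y] such that
[|f x| <= |T f y|] for every [f]. Domination applied to a function [h] peaking
at [x] makes [|T h|] bounded by some [q < 1] off any neighbourhood of [K],
whereas its norm is near [1]; so [K] is a nonempty weak peak set
([partner_set_weak_peak]) and contains a weak peak point [y]. The same argument
from [y] back to [X] gives [x'] with [|f x| <= |T f y| <= |f x'|] for all [f],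
and functions peaking at [x] force [x' = x]. Thus [|T f y| = |f x|]
([Choquet_partner]); the two maps so obtained are inverse to each other, and
peaking functions make them continuous.

It remains to identify the weak peak points with the Choquet boundary, defined
by extreme states. If [x] is a weak peak point and evaluation at [x] is a proper
convex combination of states, both states nearly attain their norm on functions
peaking at [x], hence agree with the evaluation ([weak_peak_point_Choquet]).
Conversely, let evaluation at [x] be extreme. By Hahn-Banach the infimum of
[Re f x] over the [f] in [A] whose real part majorizes the indicator of the
complement of a neighbourhood [U] of [x] is [L] of that indicator, for a
positive functional [L] representing [x]. Weighting [L] by a bounded function
decomposes the evaluation, so extremality makes [L] multiplicative enough to
kill [|f - f x|^2], and then, by compactness, the indicator itself. So there are
[f] in [A] with [Re f >= 0], [Re f >= 1] off [U] and [Re f x] small, and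
[1 / (1 + C (f - i Im f x))] peaks at [x] ([Choquet_weak_peak_point]). *)

(** * Powers, the modulus and the supremum norm *)

Section Powers.
Variable R : realType.

Lemma expr_lt_small (q e : R) : 0 <= q < 1 -> 0 < e -> exists n, q ^+ n < e.
Proof.
move=> /andP[q0 q1] e0.
have : `|q| < 1 by rewrite ger0_norm.
move=> /cvg_expr /cvgrPdist_lt /(_ e e0) [n _ /(_ n (leqnn n))] /=.
by rewrite sub0r normrN ger0_norm ?exprn_ge0 // => ?; exists n.
Qed.

Lemma expr_near1 n (e : R) : 0 < e -> exists2 d : R, 0 < d & (1 + d) ^+ n <= 1 + e.
Proof.
elim: n e => [|n IHn] e e0; first by exists 1; rewrite // expr0 lerDl ltW.
have e2 : 0 < e / 2 by rewrite divr_gt0.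
have [d d0 dn] := IHn _ e2; have e02 : 0 < 2 + e by rewrite addr_gt0.
(* [(1 + e / 2) (1 + e / (2 + e)) = 1 + e]. *)
exists (Num.min d (e / (2 + e))); first by rewrite lt_min d0 divr_gt0.
set m := Num.min _ _; have m0 : 0 < m by rewrite lt_min d0 divr_gt0.
rewrite exprSr; apply: (@le_trans _ _ ((1 + e / 2) * (1 + e / (2 + e)))).
  apply: ler_pM; rewrite ?exprn_ge0 ?addr_ge0 ?(ltW m0) //.
    apply: le_trans dn; rewrite lerXn2r ?nnegrE ?addr_ge0 ?(ltW m0) ?(ltW d0) //.
    by rewrite lerD2l ge_min lexx.
  by rewrite lerD2l ge_min lexx orbT.
rewrite le_eqVlt; apply/orP; left; apply/eqP; field.
by rewrite gt_eqF.
Qed.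

End Powers.

Section Modulus.
Variable R : realType.
Implicit Types z w : R[i].

Lemma normc_ge0 z : 0 <= normc z.
Proof. by case: z => a b; rewrite sqrtr_ge0. Qed.

Lemma normc_add_le z w : normc (z + w) <= normc z + normc w.
Proof. exact: (le_normcD (z : Rcomplex R) w). Qed.

Lemma normc_opp z : normc (- z) = normc z.
Proof. exact: (normcN (z : Rcomplex R)). Qed.

Lemma normc_sub_sym z w : normc (z - w) = normc (w - z).
Proof. by rewrite -opprB normc_opp. Qed.

Lemma normc_sub_le z w : normc z - normc w <= normc (z - w).
Proof. by rewrite lerBlDr -{1}[z](subrK w) normc_add_le. Qed.

Lemma normcX z n : normc (z ^+ n) = normc z ^+ n.
Proof.
by elim: n => [|n IHn]; rewrite ?expr0 ?normc1 // !exprS normcM IHn.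
Qed.

Lemma normc_gt0 z : z != 0 -> 0 < normc z.
Proof.
move=> z0; rewrite lt_neqAle normc_ge0 andbT eq_sym.
by apply: contra z0 => /eqP/eq0_normc ->.
Qed.

Lemma normc_real (a : R) : normc a%:C = `|a|.
Proof. by rewrite /= expr0n /= addr0 sqrtr_sqr. Qed.

Lemma sqr_normcE z : normc z ^+ 2 = complex.Re z ^+ 2 + complex.Im z ^+ 2.
Proof. by case: z => a b; rewrite sqr_sqrtr // addr_ge0 ?sqr_ge0. Qed.

Lemma Re_le_normc z : complex.Re z <= normc z.
Proof.
apply: (le_trans (ler_norm _)).
by rewrite -sqrtr_sqr; case: z => a b; rewrite ler_sqrt ?lerDl ?addr_ge0 ?sqr_ge0.
Qed.

Lemma continuous_normc_near (X : topologicalType) (f : X -> R[i]) x (e : R) :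
  {for x, continuous f} -> 0 < e -> \forall y \near x, normc (f y - f x) < e.
Proof.
move=> /cvgrPdist_lt fx e0; near=> y; rewrite normc_sub_sym.
have : `|f x - f y| < e%:C by near: y; apply: fx; rewrite ltcE /= eqxx.
by rewrite ltcE /= => /andP[].
Unshelve. all: by end_near. Qed.

Lemma continuous_normc (X : topologicalType) (f : X -> R[i]) :
  continuous f -> continuous (fun x => normc (f x)).
Proof.
move=> cf x; apply/cvgrPdist_lt => e e0.
apply: filterS (continuous_normc_near (cf x) e0) => y /(le_lt_trans _); apply.
rewrite ler_norml normc_sub_sym normc_sub_le andbT.
by rewrite lerNl opprB normc_sub_sym normc_sub_le.
Qed.

End Modulus.

Section SupremumNorm.
Variables (R : realType) (X : topologicalType) (cptX : compact [set: X]).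
Implicit Types f : X -> R[i].

Lemma continuous_normc_bounded f : continuous f ->
  exists2 M, 0 < M & forall x, normc (f x) <= M.
Proof.
move=> cf; have cn : continuous (fun x => normc (f x)) by exact: continuous_normc.
have : compact ((fun x => normc (f x)) @` [set: X]).
  by apply: continuous_compact => //; exact: continuous_subspaceT.
move=> /compact_bounded /ex_strict_bound_gt0[M M0 MP].
exists M => // x; rewrite (le_trans (ler_norm _)) // ltW //.
by apply: MP; exists x.
Qed.

Lemma normc_le_supnorm f x : continuous f -> normc (f x) <= supnorm setT f.
Proof.
move=> /continuous_normc_bounded[M _ MP]; apply: ub_le_sup; last by exists x.
by exists M => _ [y _ <-].
Qed.

Lemma supnorm_le f (M : R) :
  0 <= M -> (forall x, normc (f x) <= M) -> supnorm setT f <= M.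
Proof.
move=> M0 MP; have [X0|X0] := eqVneq [set normc (f x) | x in [set: X]] set0.
  by rewrite /supnorm X0 sup0.
by apply: ge_sup; [exact/set0P | move=> _ [y _ <-]].
Qed.

End SupremumNorm.

(** * Algebra in a uniform algebra *)

Section UniformAlgebraTheory.
Variables (R : realType) (X : topologicalType) (cptX : compact [set: X]).
Variables (A : set (X -> R[i])) (unifA : uniform_algebra A).
Implicit Types f g : X -> R[i].

Lemma ua_scale (c : R[i]) f : A f -> A (fun x => c * f x).
Proof. by move=> Af; apply: (ua_mul unifA) (ua_cst unifA c) Af. Qed.

Lemma ua_add_cst (c : R[i]) f : A f -> A (fun x => f x + c).
Proof. by move=> Af; apply: (ua_add unifA) Af (ua_cst unifA c). Qed.

Lemma ua_exp f n : A f -> A (fun x => f x ^+ n).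
Proof.
move=> Af; elim: n => [|n IHn]; first exact: (ua_cst unifA 1).
rewrite (_ : (fun _ => _) = f * fun x => f x ^+ n).
  exact: (ua_mul unifA).
by apply/funext => x; rewrite exprS.
Qed.

(** Closedness in the uniform topology, put in terms of the real-valued
    modulus. *)
Lemma ua_uniform_limit f : (forall e : R, 0 < e ->
  exists2 g, A g & forall x, normc (f x - g x) <= e) -> A f.
Proof.
move=> fP; apply: (ua_closed unifA) => P /uniform_nbhs[E [entE EP]].
move: entE; rewrite -entourage_ballE => -[e /= e0 eE].
move: e0; rewrite lt_def => /andP[e0].
rewrite lecE /= => /andP[/eqP e1 e2].
have er : e = (complex.Re e)%:C by case: (e) e1 => a b /= ->.
have e3 : 0 < complex.Re e.
  by rewrite lt_neqAle e2 andbT; apply: contra e0 => /eqP; rewrite er /= => <-.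
have [g Ag fg] := fP _ (divr_gt0 e3 (ltr0Sn _ 1)).
exists g; split => //; apply: EP => y _; apply: eE.
rewrite /= -ball_normE /= er ltcE /= eqxx /=.
by rewrite (le_lt_trans (fg y)) // ltr_pdivrMr // ltr_pMr // ltr1n.
Qed.

End UniformAlgebraTheory.

Section Invertibles.
Variables (R : realType) (X : topologicalType) (cptX : compact [set: X]).
Variables (A : set (X -> R[i])) (unifA : uniform_algebra A).
Implicit Types f g w : X -> R[i].

Lemma invertible_neq0 f x : invertibles A f -> f x != 0.
Proof.
move=> -[_ [g _ /(congr1 (fun h => h x))]]; rewrite /= => fg1.
by apply: contra_eq_neq fg1 => f0; rewrite mulrfctE f0 mul0r eq_sym oner_eq0.
Qed.

Lemma invertible_inv f : invertibles A f -> invertibles A (fun x => (f x)^-1).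
Proof.
move=> invf; have [Af [g Ag fg]] := invf.
have gE : g = fun x => (f x)^-1.
  apply/funext => x; apply: (mulfI (invertible_neq0 x invf)).
  by rewrite divff ?invertible_neq0 //; exact: (congr1 (fun h => h x) fg).
by rewrite -gE; split => //; exists f => //; rewrite mulrC.
Qed.

Lemma invertible_mul f g :
  invertibles A f -> invertibles A g -> invertibles A (f * g).
Proof.
move=> [Af [f' Af' ff']] [Ag [g' Ag' gg']]; split; first exact: (ua_mul unifA).
by exists (f' * g'); [exact: (ua_mul unifA) | rewrite mulrACA ff' gg' mulr1].
Qed.

Lemma invertible_cst (c : R[i]) : c != 0 -> invertibles A (fun _ => c).
Proof.
move=> c0; split; first exact: (ua_cst unifA).
exists (cst c^-1); first exact: (ua_cst unifA).
by apply/funext => x; rewrite mulrfctE /= divff.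
Qed.

Lemma invertible_scale (c : R[i]) f :
  c != 0 -> invertibles A f -> invertibles A (fun x => c * f x).
Proof. by move=> /invertible_cst ic /(invertible_mul ic). Qed.

Lemma invertible_exp f n :
  invertibles A f -> invertibles A (fun x => f x ^+ n).
Proof.
move=> invf; elim: n => [|n IHn]; first exact/invertible_cst/oner_neq0.
rewrite (_ : (fun _ => _) = f * fun x => f x ^+ n).
  exact: invertible_mul.
by apply/funext => x; rewrite exprS.
Qed.

(** For [N] large the values of [1 - w / N] have modulus less than a constant
    below [1], so the Neumann series of [1 / w] converges uniformly. *)
Lemma invertible_Re_ge1 w : A w -> (forall x, 1 <= complex.Re (w x)) ->
  invertibles A w.
Proof.
move=> Aw w1; have [M M0 MP] := continuous_normc_bounded cptX (ua_continuous unifA Aw).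
have w_ge1 x : 1 <= normc (w x) by apply: le_trans (w1 x) (Re_le_normc _).
have w0 x : w x != 0.
  by apply/eqP => wx0; have := w_ge1 x; rewrite wx0 normc0 ler10.
(* From [Re w >= 1] and [|w| <= M], this [N] gives [|1 - w / N|^2 <= 1 - 1 / N]. *)
pose N := M ^+ 2 + 1; have N0 : 0 < N by rewrite ltr_wpDl ?sqr_ge0.
pose z x : R[i] := (- N^-1)%:C * w x + 1.
have Az : A z by apply: (ua_add_cst unifA 1); exact: ua_scale.
have zN x : normc (z x) ^+ 2 <= 1 - N^-1.
  have : complex.Re (w x) ^+ 2 + complex.Im (w x) ^+ 2 <= M ^+ 2.
    by rewrite -sqr_normcE lerXn2r ?nnegrE ?normc_ge0 ?(ltW M0).
  rewrite sqr_normcE /z; move: (w1 x); case: (w x) => a b /= a1 ab.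
  rewrite !mul0r subr0 !addr0.
  have -> : (- N^-1 * a + 1) ^+ 2 + (- N^-1 * b) ^+ 2
     = 1 - N^-1 * (2 * a) + N^-1 ^+ 2 * (a ^+ 2 + b ^+ 2) by ring.
  have NV0 : 0 < N^-1 by rewrite invr_gt0.
  have : N^-1 ^+ 2 * (a ^+ 2 + b ^+ 2) <= N^-1.
    rewrite expr2 -mulrA ger_pMr // mulrC ler_pdivrMr // mul1r /N.
    by rewrite (le_trans ab) // lerDl.
  have : N^-1 <= N^-1 * a by rewrite ler_pMr.
  lra.
split=> //; exists (fun x => (w x)^-1); last first.
  by apply/funext => x; rewrite mulrfctE divff.
apply: (ua_uniform_limit unifA) => e e0.
have q01 : 0 <= 1 - N^-1 < 1.
  rewrite subr_ge0 invf_le1 // gtrBl invr_gt0 N0 andbT.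
  by rewrite /N lerDr sqr_ge0.
have [n ne] := expr_lt_small q01 e0.
pose S m x := \sum_(j < m) z x ^+ j.
have AS m : A (S m).
  elim: m => [|m IHm].
    rewrite (_ : S 0 = cst 0); first exact: (ua_cst unifA).
    by apply/funext => x; rewrite /S big_ord0.
  rewrite (_ : S m.+1 = S m + (fun x => z x ^+ m)).
    by apply: (ua_add unifA) => //; exact: ua_exp.
  by apply/funext => x; rewrite /S big_ord_recr.
exists (fun x => (N^-1)%:C * S n.*2 x); first exact: ua_scale.
move=> x.
have zw : z x - 1 = - ((N^-1)%:C * w x) by rewrite /z addrK rmorphN mulNr.
have -> : (w x)^-1 - (N^-1)%:C * S n.*2 x = z x ^+ n.*2 / w x.
  apply: (mulIf (w0 x)); rewrite mulrBl mulVf // divfK //.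
  rewrite -[z x ^+ _](subrK 1) subrX1 zw -/(S _ _) mulNr.
  by rewrite -mulrA [S _ _ * _]mulrC mulrA [_ + 1]addrC.
rewrite normcM normcX normcV -mul2n exprM.
apply: le_trans (ltW ne).
apply: (@le_trans _ _ ((normc (z x) ^+ 2) ^+ n)).
  apply: ler_piMr; first by rewrite exprn_ge0 ?sqr_ge0.
  by rewrite invf_le1 // (lt_le_trans ltr01).
by rewrite lerXn2r ?nnegrE ?sqr_ge0 //; case/andP: q01.
Qed.

End Invertibles.

(** * Compactness *)

Section Compactness.

(** The complements (in [K]) of the members of an ideal form a filter, which
    would be proper and have a cluster point in [K] if [K] were not a member.
    This replaces the extraction of finite subcovers. *)
Lemma compact_ideal (X : topologicalType) (K : set X) (P : set X -> Prop) :
  compact K -> P set0 -> (forall S S', S `<=` S' -> P S' -> P S) ->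
  (forall S S', P S -> P S' -> P (S `|` S')) ->
  (forall x, K x -> exists2 N, nbhs x N & P N) -> P K.
Proof.
move=> cK P0 PS PU PK; apply: contrapT => nPK.
pose F : set_system X := [set S | P (K `\` S)].
have FF : ProperFilter F.
  apply: Build_ProperFilter_ex => [S FS|].
    apply: contrapT => S0; apply: nPK; apply: PS FS => z Kz; split=> // Sz.
    by apply: S0; exists z.
  split; first by rewrite /F /= setDT.
  - by move=> S S' FS FS'; rewrite /F /= setDIr; exact: PU.
  - by move=> S S' SS'; apply: PS => z [Kz nS'z]; split=> // /SS'.
have FK : F K by rewrite /F /= setDv.
have [x [Kx clF]] := cK F FF FK; have [N Nx PN] := PK x Kx.
have [|z []//] := clF (~` N) N _ Nx.
by apply: PS PN => z [_] /contrapT.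
Qed.

(** Otherwise the sets [E `\` U] generate a proper filter, and a cluster point
    of it lies in every [E] but not in [U]. *)
Lemma compact_chain_sub (X : topologicalType) (cptX : compact [set: X])
    (K : set (set X)) (U : set X) :
  open U -> K !=set0 -> (forall E, K E -> closed E) -> total_on K subset ->
  \bigcap_(E in K) E `<=` U -> exists2 E, K E & E `<=` U.
Proof.
move=> oU [E0 KE0] clK chK KU; apply: contrapT => nK.
have nsub E : K E -> E `\` U !=set0.
  move=> KE; apply/set0P/eqP; rewrite setD_eq0 => EU.
  by apply: nK; exists E.
pose F := filter_from K (fun E => E `\` U).
have FF : ProperFilter F.
  apply: filter_from_proper => //; apply: filter_from_filter; first by exists E0.
  move=> E1 E2 KE1 KE2; have [E12|E21] := chK _ _ KE1 KE2.
    by exists E1 => // x [E1x nUx]; do !split => //; exact: E12.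
  by exists E2 => // x [E2x nUx]; do !split => //; exact: E21.
have [x [_ xF]] := cptX F FF filterT.
have inE E : K E -> (E `\` U) x.
  move=> KE; have cEU : closed (E `\` U) by apply: closedI; [exact: clK|rewrite closedC].
  apply: cEU => V Vx; have [z [? ?]] := xF _ _ (ex_intro2 _ _ E KE (fun=> id)) Vx.
  by exists z.
have [_] := inE _ KE0; apply; apply: KU => E KE; by case: (inE _ KE).
Qed.

End Compactness.

(** * Weak peak sets *)

Section WeakPeakSets.
Variables (R : realType) (X : topologicalType) (cptX : compact [set: X]).
Variables (A : set (X -> R[i])) (unifA : uniform_algebra A).
Implicit Types (f g : X -> R[i]) (E U : set X).

(** A variant of the intersections of peak sets. Asking for invertible functions
    and constraining only their modulus makes the notion visible to a map that
    only preserves norms of products of invertible functions. It is weaker in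
    general (the unit circle qualifies for the disc algebra on the closed disc),
    but singletons of this kind are still Choquet points. *)
Definition weak_peak_set E := closed E /\
  forall U (e : R), open U -> E `<=` U -> 0 < e ->
  exists f, [/\ invertibles A f, forall x, E x -> 1 <= normc (f x),
    forall x, normc (f x) <= 1 + e & forall x, ~ U x -> normc (f x) <= e].

(** A fixed bound [q < 1] off [U] is as good as arbitrarily small ones: take
    powers, starting close enough to [1] that the powers stay below [1 + e]. *)
Lemma weak_peak_set_gap E : closed E ->
  (forall U, open U -> E `<=` U -> exists2 q : R, 0 < q < 1 &
    forall e : R, 0 < e ->
    exists f, [/\ invertibles A f, forall x, E x -> 1 <= normc (f x),
      forall x, normc (f x) <= 1 + e & forall x, ~ U x -> normc (f x) <= q]) ->
  weak_peak_set E.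
Proof.
move=> clE EP; split=> // U e oU EU e0.
have [q /andP[q0 q1] qP] := EP U oU EU.
have [|n qn] := @expr_lt_small _ q e _ e0; first by rewrite ltW.
have [d d0 dn] := expr_near1 n e0; have [f [invf fE fd fq]] := qP d d0.
exists (fun x => f x ^+ n); split=> [||x|x nUx]; first exact: invertible_exp.
- by move=> x Ex; rewrite normcX exprn_ege1 ?fE.
- rewrite normcX (le_trans _ dn) // lerXn2r ?nnegrE ?normc_ge0 //.
  by rewrite addr_ge0 // ltW.
- rewrite normcX (le_trans _ (ltW qn)) // lerXn2r ?nnegrE ?normc_ge0 ?(ltW q0) //.
  exact: fq.
Qed.

(** After dividing [g] by [g x0], multiply it by a function that peaks on [E]
    and is small where [|g|] is noticeably above [1]; off a neighbourhood of the
    new set the product is below [1], because [|g|] stays below [1] on the rest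
    of the compact set [E]. *)
Lemma weak_peak_set_argmax E g x0 : weak_peak_set E -> invertibles A g ->
  E x0 -> (forall x, E x -> normc (g x) <= normc (g x0)) ->
  weak_peak_set [set x | E x /\ normc (g x) = normc (g x0)].
Proof.
move=> [clE wE] invg Ex0 gmax.
have gx0 := invertible_neq0 x0 invg; have ngx0 := normc_gt0 gx0.
pose h x := (g x0)^-1 * g x.
have invh : invertibles A h by apply: invertible_scale; rewrite ?invr_eq0.
have hE x : normc (h x) = normc (g x) / normc (g x0).
  by rewrite normcM normcV mulrC.
have h1 x : E x -> normc (h x) <= 1.
  by move=> Ex; rewrite hE ler_pdivrMr // mul1r gmax.
rewrite (_ : [set x | _] = E `&` [set x | normc (h x) = 1]); last first.
  apply/seteqP; split=> x /= [Ex gx]; split=> //=; first by rewrite hE gx divff ?gt_eqF.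
  by rewrite -[RHS]mul1r -gx hE divfK ?gt_eqF.
have ch : continuous (fun x => normc (h x)).
  exact/continuous_normc/(ua_continuous unifA)/(proj1 invh).
have [M M0 MP] := continuous_normc_bounded cptX (ua_continuous unifA (proj1 invh)).
apply: weak_peak_set_gap.
  apply: closedI => //.
  exact: (closed_comp (fun x _ => ch x) (@closed_eq R 1)).
move=> U oU EU.
have [d /andP[d0 d1] dP] : exists2 d : R, 0 < d < 1 & forall x, E x -> ~ U x ->
    normc (h x) < 1 - d.
  have [E0|/set0P E0] := eqVneq (E `\` U) set0.
    exists (2^-1); first by rewrite invr_gt0 ltr0n invf_lt1 ?ltr1n ?ltr0n.
    by move=> x Ex nUx; have : (E `\` U) x by []; rewrite E0.
  have cEU : compact (E `\` U).
    apply: subclosed_compact cptX _ => //.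
    by apply: closedI => //; rewrite closedC.
  have [|c /set_mem[Ec nUc] cP] := compact_EVT_max E0 cEU (f := fun x => normc (h x)).
    exact: continuous_subspaceT.
  have hc : normc (h c) < 1.
    by rewrite lt_neqAle h1 // andbT; apply/eqP => hc1; apply: nUc; exact: EU.
  exists ((1 - normc (h c)) / 2).
    have := normc_ge0 (h c); lra.
  by move=> x Ex nUx; have := cP x (mem_set (conj Ex nUx)); lra.
exists (1 - d / 2); first by lra.
move=> e e0; have [t t0 te] := expr_near1 2 e0.
pose V := [set x | normc (h x) < 1 + t] `&` ([set x | normc (h x) < 1 - d] `|` U).
have oV : open V.
  apply: openI; first exact: (open_comp (fun x _ => ch x) (@open_lt R (1 + t))).
  apply: openU => //; exact: (open_comp (fun x _ => ch x) (@open_lt R (1 - d))).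
have EV : E `<=` V.
  move=> x Ex; split; first by apply: (le_lt_trans (h1 x Ex)); rewrite ltrDl.
  by have [Ux|nUx] := pselect (U x); [right | left; exact: dP].
pose s := Num.min t (Num.min (d / 2) ((1 - d / 2) / M)).
have s0 : 0 < s.
  by rewrite !lt_min t0 !divr_gt0 //=; lra.
have st : s <= t by rewrite ge_min lexx.
have sd : s <= d / 2 by rewrite !ge_min lexx orbT.
have sM : M * s <= 1 - d / 2 by rewrite mulrC -ler_pdivlMr // !ge_min lexx !orbT.
have [f [invf fE fs fV]] := wE V s oV EV s0.
have off x : ~ V x -> normc (h x) * normc (f x) <= 1 - d / 2.
  move=> /fV fx; apply: le_trans sM.
  by apply: ler_pM; rewrite ?normc_ge0 ?MP.
exists (h * f); split=> [|x [Ex /= hx]|x|x nUx]; first exact: invertible_mul.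
- by rewrite normcM hx mul1r fE.
- rewrite normcM; have [Vx|/off nVx] := pselect (V x); last by lra.
  apply: le_trans te; rewrite expr2; apply: ler_pM; rewrite ?normc_ge0 //.
    by case: Vx => /ltW.
  by apply: (le_trans (fs x)); rewrite lerD2l.
- rewrite normcM; have [Vx|/off nVx] := pselect (V x); last by lra.
  case: Vx => _ [/ltW hx|//].
  apply: (@le_trans _ _ ((1 - d) * (1 + s))).
    by apply: ler_pM; rewrite ?normc_ge0.
  by nra.
Qed.

End WeakPeakSets.

Section MinimalWeakPeakSets.
Variables (R : realType) (X : topologicalType) (cptX : compact [set: X]).
Variables (A : set (X -> R[i])) (unifA : uniform_algebra A).
Implicit Types (f g : X -> R[i]) (E U : set X).

(** If [Re g] separates the points, so does the modulus of one of the two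
    functions [g + c] and [g + c + 1], since
    [|z + c + 1|^2 - |z + c|^2 = 2 Re z + 2 c + 1]; for [c] large both are
    invertible. *)
Lemma invertible_separates x y : x <> y ->
  exists2 f, invertibles A f & normc (f x) <> normc (f y).
Proof.
move=> /(ua_separates unifA)[f Af fxy].
have [g Ag gxy] : exists2 g, A g & complex.Re (g x) <> complex.Re (g y).
  have [Rxy|] := eqVneq (complex.Re (f x)) (complex.Re (f y)); last first.
    by move=> /eqP; exists f.
  exists (fun x => 'i * f x); first exact: ua_scale.
  move: fxy Rxy; case: (f x) (f y) => [a b] [c d] /= acbd ac.
  by rewrite !mul0r !mul1r !sub0r => /oppr_inj bd; apply: acbd; rewrite ac bd.
have [M M0 MP] := continuous_normc_bounded cptX (ua_continuous unifA Ag).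
have inv (c : R) : M + 1 <= c -> invertibles A (fun x => g x + c%:C).
  move=> Mc; apply: (invertible_Re_ge1 cptX unifA); first exact: ua_add_cst.
  move=> z; rewrite raddfD /=.
  have := MP z; have := Re_le_normc (- g z); rewrite normc_opp raddfN /=; lra.
pose c := M + 1.
have [fc|/eqP] := eqVneq (normc (g x + c%:C)) (normc (g y + c%:C)); last first.
  by exists (fun x => g x + c%:C) => //; exact: inv.
exists (fun x => g x + (c + 1)%:C); first by apply: inv; rewrite lerDl.
move: fc => /(congr1 (fun t => t ^+ 2)) fc /(congr1 (fun t => t ^+ 2)).
rewrite !sqr_normcE; move: fc gxy; rewrite !sqr_normcE.
case: (g x) (g y) => [p q] [r s] /=; rewrite !addr0 => fc1 + fc2; apply.
by move: fc1 fc2; clear; rewrite !sqrrD; lra.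
Qed.

Lemma weak_peak_set_bigcap (K : set (set X)) : K !=set0 ->
  (forall E, K E -> weak_peak_set A E) -> total_on K subset ->
  weak_peak_set A (\bigcap_(E in K) E).
Proof.
move=> K0 wK chK; have clK E : K E -> closed E by move=> /wK[].
split; first by apply: closed_bigI => E /clK.
move=> U e oU KU e0; have [E KE EU] := compact_chain_sub cptX oU K0 clK chK KU.
have [f [invf f1 fe fU]] := (wK E KE).2 U e oU EU e0; exists f; split=> // x Kx.
by apply: f1; exact: Kx.
Qed.

(** A minimal nonempty weak peak set is a singleton: otherwise the modulus of
    some invertible function is not constant on it, and the points where this
    modulus is maximal form a smaller weak peak set. *)
Lemma weak_peak_point_in E : weak_peak_set A E -> E !=set0 ->
  exists2 x, E x & weak_peak_set A [set x].
Proof.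
move=> wE E0.
(* Zorn's lemma goes to the complements in [E]: their chains are bounded by
   unions, and a maximal [D] leaves a minimal [E `\` D]. *)
pose P (D : set X) := weak_peak_set A (E `\` D) /\ E `\` D !=set0.
have [D [[wD [x [Ex nDx]]] maxD]] : exists D, P D /\ forall D', D `<` D' -> ~ P D'.
  apply: Zorn_bigcup => F FP chF.
  have [->|/set0P F0] := eqVneq F set0; first by rewrite /P bigcup_set0 setD0.
  pose K := [set E `\` D | D in F].
  have EK : E `\` \bigcup_(D in F) D = \bigcap_(E' in K) E'.
    apply/seteqP; split=> [x [Ex nFx] _ [D FD <-]|x Kx].
      by split=> // Dx; apply: nFx; exists D.
    have [D0 FD0] := F0; split; first by have [] := Kx _ (ex_intro2 _ _ D0 FD0 erefl).
    by move=> [D FD Dx]; have [] := Kx _ (ex_intro2 _ _ D FD erefl).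
  have K0 : K !=set0 by have [D0 FD0] := F0; exists (E `\` D0); exists D0.
  have wK E' : K E' -> weak_peak_set A E' by move=> [D /FP[wD _] <-].
  have chK : total_on K subset.
    move=> _ _ [D1 FD1 <-] [D2 FD2 <-]; have [D12|D21] := chF _ _ FD1 FD2; [right|left].
      by move=> x [? nD]; split=> // /D12.
    by move=> x [? nD]; split=> // /D21.
  rewrite /P EK; split; first exact: weak_peak_set_bigcap.
  apply: contrapT => nK0.
  have [||_ [D FD <-] D0] := @compact_chain_sub _ cptX K set0 open0 K0 _ chK.
  - by move=> E' /wK[].
  - by move=> x Kx; apply: nK0; exists x.
  - by have [_ [x /D0]] := FP D FD.
exists x => //; suff -> : [set x] = E `\` D by [].
apply/seteqP; split=> [_ ->//|y EDy] /=; apply: contrapT => yx.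
have [f invf fxy] := invertible_separates yx.
have cED : compact (E `\` D) by apply: subclosed_compact cptX _ => //; case: wD.
have ED0 : E `\` D !=set0 by exists x.
have [|c /set_mem EDc cP] := compact_EVT_max ED0 cED (f := fun x => normc (f x)).
  by apply/continuous_subspaceT/continuous_normc/(ua_continuous unifA); case: invf.
have wD' := weak_peak_set_argmax cptX unifA wD invf EDc (fun z EDz => cP z (mem_set EDz)).
set E' := (E' in weak_peak_set A E') in wD'.
have E'E : E' `<=` E by move=> z [[]].
have ED' : E `\` ~` E' = E' by rewrite setDE setCK; apply/setIidr.
apply: (maxD (~` E')); last by rewrite /P ED'; split=> //; exists c.
split; first by move=> z Dz /= [[]].
move=> E'D.
have [z [EDz nE'z]] : exists z, (E `\` D) z /\ ~ E' z.
  have [xc|/eqP xc] := eqVneq (normc (f x)) (normc (f c)).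
    by exists y; split=> // -[_ yc]; apply: fxy; rewrite xc.
  by exists x; split=> // -[].
by case: EDz => _; apply; exact: E'D.
Qed.

Lemma weak_peak_point_sep x y (e : R) : hausdorff_space X -> 
  weak_peak_set A [set x] -> x <> y -> 0 < e ->
  exists f, [/\ invertibles A f, 1 <= normc (f x) & normc (f y) <= e].
Proof.
move=> T2 wx xy e0.
have cy : closed [set y] by exact/accessible_closed_set1/hausdorff_accessible.
have [||f [invf f1 _ fy]] := wx.2 (~` [set y]) e _ _ e0.
- by rewrite openC.
- by move=> _ ->.
- by exists f; split=> //; [exact: f1 | apply: fy; rewrite /= notK].
Qed.

End MinimalWeakPeakSets.

(** * Weak peak points are Choquet points *)

Section StatesAndPeakPoints.
Variables (R : realType) (X : topologicalType) (cptX : compact [set: X]).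
Variables (A : set (X -> R[i])) (unifA : uniform_algebra A).
Implicit Types (f g : X -> R[i]) (F G H : (X -> R[i]) -> R[i]).

Lemma state_add_cst G g (c : R[i]) : is_state A G -> A g ->
  G (fun x => g x + c) = G g + c.
Proof.
move=> stG Ag; have A1 := ua_cst unifA 1.
rewrite [LHS](state_add stG Ag (ua_cst unifA c)); congr (_ + _).
rewrite -[RHS]mulr1 -(state_one stG) -(state_scale stG) //; congr G.
by apply/funext => x; rewrite mulrfctE /= mulr1.
Qed.

Lemma state_le G f (M : R) : is_state A G -> A f -> 0 <= M ->
  (forall x, normc (f x) <= M) -> normc (G f) <= M.
Proof.
by move=> stG Af M0 fM; apply: le_trans (state_bound stG Af) (supnorm_le M0 fM).
Qed.

Lemma is_state_eval x : is_state A (fun f => f x).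
Proof.
split=> // f Af; exact: (normc_le_supnorm cptX x (ua_continuous unifA Af)).
Qed.

(** Suppose [g x = 0] and [G g] is not zero. After scaling, [G g = r > 0] and
    [|g| <= 1/2]. If [k] peaks at [x] with [k x = 1], then [g + k] has norm
    close to [1], because [g] is small where [k] is not; but [Re (G k)] is close
    to [1], since [H k] cannot exceed [1] by much and the two average to [1].
    Hence [Re (G (g + k))] is about [1 + r], more than the norm of [g + k]. *)
Lemma weak_peak_point_state_component x G H (t : R) : weak_peak_set A [set x] ->
  is_state A G -> is_state A H -> 0 < t < 1 ->
  {in A, forall f, f x = t%:C * G f + (1 - t)%:C * H f} ->
  {in A, forall g, G g = g x}.
Proof.
move=> [_ wx] stG stH /andP[t0 t1] GH g0 /set_mem Ag0.
suff vanish g : A g -> g x = 0 -> G g = 0.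
  apply/eqP; rewrite -subr_eq0 -(state_add_cst _ stG Ag0) vanish ?subrr //.
  exact: ua_add_cst.
move=> Ag gx; apply/eqP; apply: contrapT => /negP Gg0.
have [M M0 MP] := continuous_normc_bounded cptX (ua_continuous unifA Ag).
(* The constant multiple [h] of [g] has [G h = r] and [|h| <= 1/2]. *)
pose r := normc (G g) / (2 * M).
have r0 : 0 < r by rewrite divr_gt0 ?normc_gt0 ?mulr_gt0.
pose h x := (r%:C / G g) * g x.
have Ah : A h by exact: ua_scale.
have Gh : G h = r%:C by rewrite (state_scale stG (r%:C / G g) Ag) divfK.
have hx : h x = 0 by rewrite /h gx mulr0.
have h_le y : normc (h y) <= 1 / 2.
  rewrite normcM normcM normcV normc_real gtr0_norm // /r.
  have -> : normc (G g) / (2 * M) / normc (G g) = (2 * M)^-1.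
    by field; rewrite ?gt_eqF ?normc_gt0.
  by rewrite mulrC ler_pdivrMr ?mulr_gt0 // mulrA divfK ?mul1r ?pnatr_eq0.
pose U := [set y | normc (h y) < r / 3].
have oU : open U.
  apply: (open_comp _ (@open_lt R (r / 3))) => y _.
  exact: continuous_normc (ua_continuous unifA Ah) y.
have e0 : 0 < t * r / 3 by have := mulr_gt0 t0 r0; lra.
have xU : [set x] `<=` U by move=> _ -> /=; rewrite /U /= hx normc0 divr_gt0.
have [k0 [invk0 k01 k0e k0U]] := wx U _ oU xU e0.
set e := t * r / 3 in e0 k0e k0U.
have k0x : 1 <= normc (k0 x) by exact: k01.
pose k y := (k0 x)^-1 * k0 y.
have Ak : A k by apply: (ua_scale unifA); case: invk0.
have kx : k x = 1 by rewrite /k mulVf // (invertible_neq0 x invk0).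
have kk0 y : normc (k y) <= normc (k0 y).
  rewrite normcM normcV ler_piMl ?normc_ge0 // invf_le1 //.
  exact: lt_le_trans ltr01 k0x.
have ke y : normc (k y) <= 1 + e by exact: le_trans (kk0 y) (k0e y).
have kU y : ~ U y -> normc (k y) <= e by move=> /k0U; apply: le_trans (kk0 y).
have Re_le G' f B : is_state A G' -> A f -> 0 <= B -> (forall y, normc (f y) <= B) ->
    complex.Re (G' f) <= B.
  by move=> stG' Af B0 fB; apply: le_trans (Re_le_normc _) (state_le stG' Af B0 fB).
have Hk : complex.Re (H k) <= 1 + e by apply: Re_le => //; lra.
have Gk : complex.Re (G (h + k)) <= 1 + e + r / 3.
  apply: Re_le => //; [exact: (ua_add unifA) | by lra | move=> y].
  apply: (le_trans (normc_add_le _ _)).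
  have [Uy|/kU nUy] := pselect (U y); first by have := ke y; move: Uy; rewrite /U /=; lra.
  by have := h_le y; lra.
move: Gk; rewrite (state_add stG Ah Ak) Gh raddfD /= => Gk.
have := congr1 (@complex.Re R) (GH k (mem_set Ak)).
rewrite kx; case: (G k) (H k) Gk Hk => [a b] [c d] /=; rewrite !mul0r !subr0.
rewrite /e; move=> Gk Hk E.
have : t * (r + a) <= t * (1 + t * r / 3 + r / 3) by rewrite ler_wpM2l // ltW.
have : (1 - t) * c <= (1 - t) * (1 + t * r / 3) by rewrite ler_wpM2l // subr_ge0 ltW.
have tr := mulr_gt0 t0 r0.
have ttr := mulr_gt0 t0 tr.
move: E tr ttr; clear; nra.
Qed.

Lemma weak_peak_point_Choquet x :
  weak_peak_set A [set x] -> Choquet_boundary A x.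
Proof.
move=> wx; split; first exact: is_state_eval.
move=> G H t stG stH /[dup] t01 /andP[t0 t1] GH; split.
  exact: weak_peak_point_state_component wx stG stH t01 GH.
apply: (@weak_peak_point_state_component _ _ G (1 - t)) => //.
  by apply/andP; split; lra.
by move=> f Af; rewrite GH // addrC subKr.
Qed.

End StatesAndPeakPoints.

(** * The Hahn-Banach theorem *)

Section SublinearFunctionals.
Variables (R : realType) (V : lmodType R).
Implicit Types (p q : V -> R) (u v w : V).

Definition sublinear p := (forall u v, p (u + v) <= p u + p v) /\
  (forall (a : R) u, 0 < a -> p (a *: u) = a * p u).

Lemma sublinear0 p : sublinear p -> p 0 = 0.
Proof. by move=> [_ /(_ 2 0 (ltr0Sn _ 1))]; rewrite scaler0; lra. Qed.

Lemma sublinear_opp_ge p u : sublinear p -> - p (- u) <= p u.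
Proof.
move=> sp; rewrite -subr_ge0 opprK -(sublinear0 sp) -(subrr u).
exact: sp.1.
Qed.

(** Common ground for three constructions: a partial infimum of a sublinear
    functional along a ray, the infimum of a chain of sublinear functionals, and
    the infimum of the real parts that majorize a function. *)
Lemma inf_sublinear (S : V -> set R) :
  (forall u, has_inf (S u)) ->
  (forall u v a b, S u a -> S v b -> exists2 c, S (u + v) c & c <= a + b) ->
  (forall (t : R) u a, 0 < t -> S u a ->
    exists2 b, S (t *: u) b & b <= t * a) ->
  sublinear (fun u => inf (S u)).
Proof.
move=> Sinf SD SZ.
have infle u a : S u a -> inf (S u) <= a by apply: ge_inf; exact: (Sinf u).2.
have leinf u m : (forall a, S u a -> m <= a) -> m <= inf (S u).
  by move=> mS; apply: lb_le_inf => //; exact: (Sinf u).1.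
have leZ (t : R) u : 0 < t -> inf (S (t *: u)) <= t * inf (S u).
  move=> t0; rewrite -ler_pdivrMl //; apply: leinf => a /(SZ t _ _ t0)[b Sb ba].
  by rewrite ler_pdivrMl //; exact: le_trans (infle _ _ Sb) ba.
split=> [u v|t u t0].
  rewrite -lerBlDr; apply: (leinf u) => a Sa; rewrite lerBlDr -lerBlDl.
  apply: leinf => b Sb; rewrite lerBlDl.
  by have [c Sc cab] := SD _ _ _ _ Sa Sb; exact: le_trans (infle _ _ Sc) cab.
apply: le_anti; rewrite leZ //= -ler_pdivlMl //.
by rewrite -{1}[u](scalerK (lt0r_neq0 t0)) leZ // invr_gt0.
Qed.

(** Take [q u = inf (p (u + t v) - t p v)] over [t >= 0]; the value [t = 0]
    gives [q <= p], and [t = 1] gives the bound at [- v]. *)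
Lemma sublinear_lower p v : sublinear p ->
  exists q, [/\ sublinear q, forall u, q u <= p u & q (- v) <= - p v].
Proof.
move=> sp; pose S u := [set p (u + t *: v) - t * p v | t in [set t : R | 0 <= t]].
have pZ (t : R) : 0 <= t -> p (t *: v) = t * p v.
  rewrite le_eqVlt => /orP[/eqP <-|/sp.2 //].
  by rewrite scale0r mul0r sublinear0.
have Slb u : lbound (S u) (- p (- u)).
  move=> _ [t /= t0 <-]; rewrite -pZ //.
  have := sp.1 (t *: v + u) (- u); rewrite addrK [t *: v + u]addrC; lra.
have Sinf u : has_inf (S u).
  split; last by exists (- p (- u)).
  by exists (p (u + 0 *: v) - 0 * p v); exists 0 => //=.
have infle u (t : R) : 0 <= t -> inf (S u) <= p (u + t *: v) - t * p v.
  by move=> t0; apply: ge_inf; [exact: (Sinf u).2 | exists t].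
exists (fun u => inf (S u)); split.
- apply: inf_sublinear => // [u w _ _ [s /= s0 <-] [t /= t0 <-]|t u _ t0 [s /= s0 <-]].
    exists (p (u + w + (s + t) *: v) - (s + t) * p v).
      by exists (s + t) => //=; rewrite addr_ge0.
    have := sp.1 (u + s *: v) (w + t *: v); rewrite addrACA -scalerDl; lra.
  exists (p (t *: u + (t * s) *: v) - (t * s) * p v).
    by exists (t * s) => //=; rewrite mulr_ge0 // ltW.
  by rewrite -scalerA -scalerDr sp.2 // mulrBr mulrA.
- by move=> u; apply: le_trans (infle u 0 (lexx _)) _; rewrite scale0r addr0 mul0r subr0.
- apply: le_trans (infle _ 1 ler01) _.
  by rewrite scale1r addNr sublinear0 // mul1r sub0r.
Qed.

(** Zorn's lemma for the reverse pointwise order; the bound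
    [- p (- u) <= q u] keeps the infimum of a chain finite. *)
Lemma sublinear_minimal p : sublinear p ->
  exists q, [/\ sublinear q, forall u, q u <= p u &
    forall q', sublinear q' -> (forall u, q' u <= q u) -> q' = q].
Proof.
move=> sp; pose T := {q | sublinear q /\ forall u, q u <= p u}.
pose below (q q' : T) := `[< forall u, sval q' u <= sval q u >].
have [|||C chC|q qmin] := @Zorn T below.
- by move=> q; apply/asboolP.
- move=> q1 q2 q3 /asboolP q12 /asboolP q23; apply/asboolP => u.
  exact: le_trans (q23 u) (q12 u).
- move=> [q1 q1P] [q2 q2P] /asboolP q12 /asboolP q21.
  by apply: eq_exist; apply/funext => u; apply: le_anti; rewrite q12 q21.
- have [->|/set0P[q0 Cq0]] := eqVneq C set0.
    by exists (exist _ p (conj sp (fun u => lexx _))) => ? [].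
  pose S u := [set sval q u | q in C].
  have Sinf u : has_inf (S u).
    split; first by exists (sval q0 u); exists q0.
    exists (- p (- u)) => _ [[q [sq qp]] /= _ <-].
    by apply: le_trans (sublinear_opp_ge u sq); rewrite lerN2.
  have infle u (q : T) : C q -> inf (S u) <= sval q u.
    by move=> Cq; apply: ge_inf; [exact: (Sinf u).2 | exists q].
  have sS : sublinear (fun u => inf (S u)).
    apply: inf_sublinear => // [u w _ _ [q1 C1 <-] [q2 C2 <-]|t u _ t0 [q Cq <-]].
      have [/asboolP q21|/asboolP q12] := chC _ _ C1 C2.
        exists (sval q2 (u + w)); first by exists q2.
        by apply: le_trans ((svalP q2).1.1 u w) _; rewrite lerD2r.
      exists (sval q1 (u + w)); first by exists q1.
      by apply: le_trans ((svalP q1).1.1 u w) _; rewrite lerD2l.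
    by exists (sval q (t *: u)); [exists q | rewrite (svalP q).1.2].
  have Sp u : inf (S u) <= p u by apply: le_trans (infle u q0 Cq0) ((svalP q0).2 u).
  by exists (exist _ (fun u => inf (S u)) (conj sS Sp)) => q Cq; apply/asboolP => u; exact: infle.
- exists (sval q); split; [exact: (svalP q).1 | exact: (svalP q).2 |].
  move=> q' sq' q'q; have q'p u : q' u <= p u := le_trans (q'q u) ((svalP q).2 u).
  by have /(_ _)/(congr1 sval) := qmin (exist _ q' (conj sq' q'p)); apply; apply/asboolP.
Qed.

(** A minimal sublinear functional is linear, for [sublinear_lower] applied to
    it yields [L (- u) <= - L u]. Lowering [p] along [v] before minimizing forces
    the value at [v]. *)
Lemma hahn_banach p v : sublinear p ->
  exists L : V -> R, [/\ forall (a : R) u w, L (a *: u + w) = a * L u + L w,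
    forall u, L u <= p u & L v = p v].
Proof.
move=> /[dup] sp /(sublinear_lower v)[p' [sp' p'p p'v]].
have [L [sL Lp' Lmin]] := sublinear_minimal sp'.
have LN u : L (- u) = - L u.
  have [q [sq qL qu]] := sublinear_lower u sL; rewrite (Lmin q) // in qu.
  by apply: le_anti; rewrite qu lerNl sublinear_opp_ge.
have LD u w : L (u + w) = L u + L w.
  apply: le_anti; rewrite sL.1 /= -lerBrDr -LN.
  by rewrite -{1}[u](addrK w) sL.1.
have LZ (a : R) u : L (a *: u) = a * L u.
  have [a0|a0|->] := ltrgtP a 0; last by rewrite scale0r mul0r sublinear0.
    rewrite -[a]opprK scaleNr LN sL.2 ?oppr_gt0 //; ring.
  exact: sL.2.
have Lp u : L u <= p u by exact: le_trans (Lp' u) (p'p u).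
exists L; split=> // [a u w|]; first by rewrite LD LZ.
apply: le_anti; rewrite Lp /= -lerN2 -LN.
exact: le_trans (Lp' _) p'v.
Qed.

End SublinearFunctionals.

(** * Positive functionals on bounded functions *)

Section BoundedFunctions.
Variables (R : realType) (X : Type).

Definition fun_bounded (u : X -> R) := exists M : R, forall x, `|u x| <= M.

Definition fun_bounded_pred : {pred X -> R} := fun u => `[< fun_bounded u >].

Lemma fun_bounded_lin (a : R) (u w : X -> R) :
  fun_bounded u -> fun_bounded w -> fun_bounded (a *: u + w).
Proof.
move=> [M MP] [N NP]; exists (`|a| * M + N) => x.
apply: le_trans (ler_normD _ _) _; apply: lerD => //.
by rewrite normrM ler_wpM2l.
Qed.

Lemma fun_bounded_submod : submod_closed fun_bounded_pred.
Proof.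
split; first by apply/asboolP; exists 0 => x; rewrite normr0.
by move=> a u w /asboolP bu /asboolP bw; apply/asboolP/fun_bounded_lin.
Qed.

HB.instance Definition _ :=
  GRing.isSubmodClosed.Build R (X -> R) fun_bounded_pred fun_bounded_submod.

(** Sublinearity of the infimum of majorants needs every function to have
    majorants, whence the restriction to bounded functions; they need not be
    continuous, so that indicators are allowed. *)
Definition bounded_function := {u : X -> R | u \in fun_bounded_pred}.

HB.instance Definition _ := SubChoice.on bounded_function.

HB.instance Definition _ := [SubChoice_isSubLmodule of bounded_function by <:].

End BoundedFunctions.

Section PositiveFunctionals.
Variables (R : realType) (X : topologicalType) (cptX : compact [set: X]).
Variables (A : set (X -> R[i])) (unifA : uniform_algebra A).
Implicit Types (f g : X -> R[i]) (u v w h : X -> R) (L M : (X -> R) -> R).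

Definition positive_functional L :=
  [/\ forall (a : R) u w, fun_bounded u -> fun_bounded w ->
        L (a *: u + w) = a * L u + L w,
      forall u w, fun_bounded u -> fun_bounded w ->
        (forall z, u z <= w z) -> L u <= L w
    & L (cst 1) = 1].

Lemma fun_bounded_cst (c : R) : @fun_bounded R X (cst c).
Proof. by exists `|c|. Qed.

Lemma fun_boundedM u w : fun_bounded u -> fun_bounded w -> fun_bounded (u * w).
Proof.
move=> [M MP] [N NP]; exists (M * N) => z.
by rewrite normrM ler_pM.
Qed.

Lemma fun_boundedZ (a : R) u : fun_bounded u -> fun_bounded (a *: u).
Proof.
move=> bu; have := fun_bounded_lin a bu (fun_bounded_cst 0).
by rewrite addr0.
Qed.

Lemma fun_boundedD u w : fun_bounded u -> fun_bounded w -> fun_bounded (u + w).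
Proof. by move=> bu bw; have := fun_bounded_lin 1 bu bw; rewrite scale1r. Qed.

Lemma fun_bounded_indic (N : set X) : @fun_bounded R X (\1_N).
Proof. by exists 1 => z; rewrite indicE ger0_norm // lern1 leq_b1. Qed.

Lemma fun_bounded_Re f : A f -> fun_bounded (fun z => complex.Re (f z)).
Proof.
move=> Af; have [M _ MP] := continuous_normc_bounded cptX (ua_continuous unifA Af).
exists M => z; apply: le_trans (MP z); rewrite ler_norml Re_le_normc andbT.
by have := Re_le_normc (- f z); rewrite normc_opp raddfN /=; lra.
Qed.

Lemma Im_eq_Re (z : R[i]) : complex.Im z = complex.Re (- 'i * z).
Proof. by case: z => a b /=; rewrite oppr0 mul0r mulN1r opprK add0r. Qed.

Lemma fun_bounded_Im f : A f -> fun_bounded (fun z => complex.Im (f z)).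
Proof.
move=> /(ua_scale unifA (- 'i))/fun_bounded_Re.
by congr fun_bounded; apply/funext => z; rewrite Im_eq_Re.
Qed.

Section Linearity.
Variables (L : (X -> R) -> R) (posL : positive_functional L).

Lemma positive_functional0 : L 0 = 0.
Proof.
case: posL => Llin _ _.
have := Llin 1 0 0 (fun_bounded_cst 0) (fun_bounded_cst 0).
by rewrite scale1r addr0 mul1r; lra.
Qed.

Lemma positive_functionalZ (a : R) u : fun_bounded u -> L (a *: u) = a * L u.
Proof.
case: (posL) => Llin _ _ bu; have := Llin a u 0 bu (fun_bounded_cst 0).
by rewrite positive_functional0 !addr0.
Qed.

Lemma positive_functionalD u w :
  fun_bounded u -> fun_bounded w -> L (u + w) = L u + L w.
Proof. by case: posL => Llin _ _ bu bw; have := Llin 1 u w bu bw; rewrite scale1r mul1r. Qed.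

Lemma positive_functional_cst (c : R) : L (cst c) = c.
Proof.
rewrite (_ : cst c = c *: cst 1); last by apply/funext => z; rewrite -[LHS]mulr1.
by case: (posL) => _ _ L1; rewrite positive_functionalZ ?L1 ?mulr1 //; exact: fun_bounded_cst.
Qed.

End Linearity.

(** For the norm bound, rotate [f] so that the functional takes the real value
    [|G f|] at it, and use monotonicity on its real part. *)
Lemma positive_functional_state L : positive_functional L ->
  is_state A (fun f => L (fun z => complex.Re (f z)) +i* L (fun z => complex.Im (f z))).
Proof.
move=> posL; have [Llin Lmono L1] := posL.
pose G f := L (fun z => complex.Re (f z)) +i* L (fun z => complex.Im (f z)).
have Gscale (c : R[i]) f : A f -> G (cst c * f) = c * G f.
  move=> Af; have bR := fun_bounded_Re Af; have bI := fun_bounded_Im Af.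
  case: c => a b; rewrite /G.
  have -> : (fun z => complex.Re ((cst (a +i* b) * f) z)) =
      a *: (fun z => complex.Re (f z)) + (- b) *: (fun z => complex.Im (f z)).
    apply/funext => z; rewrite -[RHS]/(a * complex.Re (f z) + - b * complex.Im (f z)).
    by rewrite mulrfctE /=; case: (f z) => p q /=; rewrite mulNr.
  have -> : (fun z => complex.Im ((cst (a +i* b) * f) z)) =
      a *: (fun z => complex.Im (f z)) + b *: (fun z => complex.Re (f z)).
    apply/funext => z; rewrite -[RHS]/(a * complex.Im (f z) + b * complex.Re (f z)).
    by rewrite mulrfctE /=; case: (f z).
  rewrite !Llin ?(positive_functionalZ posL) //; try exact: fun_boundedZ.
  by apply/eqP; rewrite eq_complex /= mulNr !eqxx.
split=> //.
- move=> f g Af Ag; rewrite -[RHS]/(_ +i* _) /=.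
  rewrite -!(positive_functionalD posL); do ?[exact: fun_bounded_Re|exact: fun_bounded_Im].
  by congr (L _ +i* L _); apply/funext => z; rewrite addrfctE raddfD.
- by rewrite [X in X +i* _]L1 [X in _ +i* X](positive_functional0 posL).
move=> f Af; rewrite -[X in normc X]/(G f).
have snorm0 : 0 <= supnorm [set: X] f.
  have [[z _]|nX] := pselect ([set: X] !=set0).
    apply: le_trans (normc_ge0 (f z)) _.
    exact: (normc_le_supnorm cptX z (ua_continuous unifA Af)).
  rewrite /supnorm (_ : [set _ | _ in _] = set0) ?sup0 //.
  by apply/seteqP; split=> // y [z _ _]; apply: nX; exists z.
have [->|G0] := eqVneq (G f) 0; first by rewrite normc0.
pose c := (normc (G f))%:C / G f.
have nc : normc c = 1.
  by rewrite normcM normcV normc_real ger0_norm ?normc_ge0 // divff ?gt_eqF ?normc_gt0.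
have -> : normc (G f) = complex.Re (G (cst c * f)) by rewrite Gscale // divfK.
rewrite /= -[leRHS](positive_functional_cst posL); apply: Lmono.
- exact: (fun_bounded_Re (ua_scale unifA c Af)).
- exact: fun_bounded_cst.
move=> z; apply: le_trans (Re_le_normc _) _; rewrite mulrfctE /= normcM nc mul1r.
exact: (normc_le_supnorm cptX z (ua_continuous unifA Af)).
Qed.

(** Hahn-Banach for [p u = inf Re f x] over the [f] in [A] with [u <= Re f]: a
    linear functional below [p] is positive and represents [x], since [p u <= 0]
    when [u <= 0], and [p (Re f) <= Re f x] for [f] as well as for [- f]. *)
Lemma majorant_functional x v : fun_bounded v ->
  exists L, [/\ positive_functional L,
    forall f, A f -> L (fun z => complex.Re (f z)) = complex.Re (f x)
    & forall m : R, (forall f, A f -> (forall z, v z <= complex.Re (f z)) ->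
        m <= complex.Re (f x)) -> m <= L v].
Proof.
move=> bv.
pose S u := [set complex.Re (f x) | f in
  [set f | A f /\ forall z, u z <= complex.Re (f z)]].
pose val_ (u : bounded_function R X) : X -> R := val u.
have bval (u : bounded_function R X) : fun_bounded (val_ u).
  by apply/asboolP; exact: valP u.
have Sinf u : fun_bounded u -> has_inf (S u).
  move=> [M MP]; split; last by exists (u x) => _ [f [_ fP] <-].
  exists M; exists (cst M%:C) => //; split; first exact: (ua_cst unifA).
  by move=> z /=; apply: le_trans (ler_norm _) (MP z).
have infle u a : fun_bounded u -> S u a -> inf (S u) <= a.
  by move=> /Sinf[_ lbS]; apply: ge_inf.
have sp : sublinear (fun u : bounded_function R X => inf (S (val_ u))).
  apply: (inf_sublinear (S := fun u : bounded_function R X => S (val_ u))) => [u|u w a b|t u a t0].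
  - exact: Sinf.
  - move=> [f [Af fu] <-] [g [Ag gw] <-]; exists (complex.Re ((f + g) x)).
      exists (f + g) => //; split; first exact: (ua_add unifA).
      by move=> z; rewrite /= addrfctE raddfD /=; apply: lerD.
    by rewrite addrfctE raddfD.
  - move=> [f [Af fu] <-]; exists (complex.Re ((cst t%:C * f) x)).
      exists (cst t%:C * f) => //; split; first exact: (ua_scale unifA t%:C Af).
      move=> z; rewrite /= mulrfctE /=; move: (fu z); case: (f z) => p q /=.
      by rewrite mul0r subr0 => ?; rewrite [leLHS]/(t * _) ler_pM2l.
    by rewrite mulrfctE /=; case: (f x) => p q /=; rewrite mul0r subr0.
have vb : v \in @fun_bounded_pred R X by apply/asboolP.
have [L0 [L0lin L0p L0v]] := hahn_banach (exist _ v vb : bounded_function R X) sp.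
pose toB u (bu : fun_bounded u) : bounded_function R X :=
  exist _ u (introT (asboolP _) bu).
pose L u := if pselect (fun_bounded u) is left bu then L0 (toB u bu) else 0.
have LE u (bu : fun_bounded u) : L u = L0 (toB u bu).
  by rewrite /L; case: pselect => // bu'; congr L0; exact: val_inj.
have Llin (a : R) u w : fun_bounded u -> fun_bounded w -> L (a *: u + w) = a * L u + L w.
  move=> bu bw; rewrite (LE _ (fun_bounded_lin a bu bw)) (LE _ bu) (LE _ bw).
  by rewrite -L0lin; congr L0; exact: val_inj.
have Lle u f : fun_bounded u -> A f -> (forall z, u z <= complex.Re (f z)) ->
    L u <= complex.Re (f x).
  move=> bu Af uf; rewrite (LE _ bu); apply: le_trans (L0p _) _.
  by apply: infle => //; exists f.
have LRe f : A f -> L (fun z => complex.Re (f z)) = complex.Re (f x).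
  move=> Af; have bR := fun_bounded_Re Af; apply: le_anti; rewrite Lle //=.
  have L00 : L (cst 0) = 0.
    have := Llin 1 0 0 (fun_bounded_cst 0) (fun_bounded_cst 0).
    by rewrite scale1r addr0 mul1r; lra.
  have : L (- 1 *: (fun z => complex.Re (f z)) + cst 0) <= complex.Re (-1 * f x).
    apply: (Lle _ (fun z => -1 * f z)); first exact: fun_bounded_lin bR (fun_bounded_cst 0).
      exact: ua_scale.
    move=> z; rewrite -[leLHS]/(-1 * complex.Re (f z) + 0).
    by rewrite addr0 !mulN1r raddfN.
  rewrite Llin //; last exact: fun_bounded_cst.
  by rewrite L00 addr0 !mulN1r raddfN lerN2.
exists L; split=> //.
- split=> // [u w bu bw uw|].
    have : L (- 1 *: w + u) <= complex.Re (@cst X _ (0 : R[i]) x).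
      apply: (Lle _ (cst 0)); [exact: fun_bounded_lin | exact: (ua_cst unifA) |].
      by move=> z; rewrite -[leLHS]/(-1 * w z + u z) /= mulN1r addrC subr_le0.
    by rewrite Llin //= mulN1r addrC subr_le0.
  exact: (LRe _ (ua_cst unifA 1)).
- move=> m mP; rewrite (LE _ bv).
  have -> : toB v bv = exist _ v vb by exact: val_inj.
  rewrite L0v; apply: lb_le_inf; first by have [] := Sinf _ bv.
  by move=> _ [f [Af vf] <-]; exact: mP.
Qed.

End PositiveFunctionals.

(** * Choquet points are weak peak points *)

Section ChoquetPeakPoints.
Variables (R : realType) (X : topologicalType) (cptX : compact [set: X]).
Variables (A : set (X -> R[i])) (unifA : uniform_algebra A).
Implicit Types (f g : X -> R[i]) (u v w h : X -> R) (L : (X -> R) -> R).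

Lemma positive_functional_weight L h : positive_functional L ->
  fun_bounded h -> (forall z, 0 <= h z) -> 0 < L h ->
  positive_functional (fun u => (L h)^-1 * L (h * u)).
Proof.
move=> posL bh h0 Lh0; have [Llin Lmono L1] := posL; split.
- move=> a u w bu bw; rewrite (_ : h * _ = a *: (h * u) + h * w).
    rewrite Llin; [ring | exact: fun_boundedM | exact: fun_boundedM].
  apply/funext => z; rewrite -[LHS]/(h z * (a * u z + w z)).
  by rewrite -[RHS]/(a * (h z * u z) + h z * w z); ring.
- move=> u w bu bw uw; rewrite ler_pM2l ?invr_gt0 //.
  apply: Lmono; [exact: fun_boundedM | exact: fun_boundedM |].
  by move=> z; apply: ler_wpM2l.
- by rewrite (_ : h * _ = h) ?mulVf ?gt_eqF //; apply: mulr1.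
Qed.

Section Representing.
Variables (x : X) (chx : Choquet_boundary A x) (L : (X -> R) -> R).
Hypothesis posL : positive_functional L.
Hypothesis LRe :
  forall f, A f -> L (fun z => complex.Re (f z)) = complex.Re (f x).

Let LIm f : A f -> L (fun z => complex.Im (f z)) = complex.Im (f x).
Proof.
move=> Af; rewrite Im_eq_Re -(LRe (ua_scale unifA (- 'i) Af)); congr L.
by apply/funext => z; rewrite Im_eq_Re.
Qed.

(** For [1/4 <= h <= 3/4], the functionals [L (h u) / L h] and
    [L ((1 - h) u) / L (1 - h)] restrict to states of [A] of which evaluation
    at [x] is a convex combination, so by extremality the first one is the
    evaluation. A general bounded [h] is brought into this range by an affine
    map, and the identity is affine in [h]. *)
Lemma Choquet_multiplicative f h : A f -> fun_bounded h ->
  L (h * (fun z => complex.Re (f z))) = L h * complex.Re (f x).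
Proof.
move=> Af bh0; have bRe := fun_bounded_Re cptX unifA; have [Llin Lmono L1] := posL.
have bR := bRe f Af.
have central h' : fun_bounded h' -> (forall z, 1 / 4 <= h' z <= 3 / 4) ->
    L (h' * (fun z => complex.Re (f z))) = L h' * complex.Re (f x).
  move=> bh hz; pose h1 := cst 1 - h'.
  have bh1 : fun_bounded h1.
    rewrite /h1 -scaleN1r addrC; apply: fun_bounded_lin bh _; exact: fun_bounded_cst.
  have Lh1 : L h1 = 1 - L h'.
    by rewrite /h1 -scaleN1r addrC Llin ?L1 ?mulN1r 1?addrC //; exact: fun_bounded_cst.
  have : 1 / 4 <= L h' <= 3 / 4.
    rewrite -(positive_functional_cst posL (1 / 4)).
    rewrite -(positive_functional_cst posL (3 / 4)).
    by rewrite !Lmono //; try (exact: fun_bounded_cst); move=> z; case/andP: (hz z).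
  set t := L h' => /andP[t1 t2].
  have pos0 : positive_functional (fun u => t^-1 * L (h' * u)).
    apply: positive_functional_weight => // [z|]; last by rewrite -/t; lra.
    by have := hz z; lra.
  have pos1 : positive_functional (fun u => (1 - t)^-1 * L (h1 * u)).
    rewrite -Lh1; apply: positive_functional_weight => // [z|].
      by rewrite -[leRHS]/(1 - h' z); have := hz z; lra.
    by rewrite Lh1 -/t; lra.
  have split_L u : fun_bounded u ->
      t * (t^-1 * L (h' * u)) + (1 - t) * ((1 - t)^-1 * L (h1 * u)) = L u.
    move=> bu; rewrite !mulrA !divff ?gt_eqF ?mul1r; try lra.
    rewrite -(positive_functionalD posL); try exact: fun_boundedM.
    congr L; apply/funext => z.
    by rewrite -[LHS]/(h' z * u z + (1 - h' z) * u z); ring.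
  have t01 : 0 < t < 1 by apply/andP; split; lra.
  have [_ /(_ _ _ t (positive_functional_state cptX unifA pos0)
    (positive_functional_state cptX unifA pos1) t01)] := chx.
  case=> [g /set_mem Ag /=|/(_ f (mem_set Af))].
    apply/eqP; rewrite eq_complex /= !mul0r !subr0 !addr0.
    rewrite !split_L; [|exact: (fun_bounded_Im cptX unifA)|exact: bRe].
    by rewrite LRe // LIm // !eqxx.
  move=> /(congr1 (@complex.Re R)) /= <- _.
  by rewrite mulrA divff ?mul1r // gt_eqF //; lra.
have [M MP] := bh0.
pose M' := `|M| + 1; have M0 : 0 < M' by rewrite ltr_wpDl.
have hM z : `|h z| <= M'.
  by apply: le_trans (MP z) _; rewrite (le_trans (ler_norm _)) // lerDl.
(* Then [s h + 1/2] has values between [1/4] and [3/4]. *)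
pose s := (4 * M')^-1; have s0 : 0 < s by rewrite invr_gt0 mulr_gt0.
have bc : @fun_bounded R X (cst (1 / 2)) by exact: fun_bounded_cst.
have /central : fun_bounded (s *: h + cst (1 / 2)) by exact: fun_bounded_lin.
rewrite (_ : (s *: h + cst (1 / 2)) * (fun z => complex.Re (f z)) =
  s *: (h * (fun z => complex.Re (f z))) + (1 / 2) *: (fun z => complex.Re (f z))).
  rewrite !Llin //; try exact: fun_boundedM; try exact: fun_boundedZ.
  rewrite (positive_functionalZ posL) // LRe // (positive_functional_cst posL).
  rewrite [(_ * L h + _) * _]mulrDl => E; apply: (mulfI (lt0r_neq0 s0)).
  rewrite mulrA; apply: (addIr (1 / 2 * complex.Re (f x))); apply: E => z.
  rewrite -[s *: h + _]/(fun z => s * h z + 1 / 2).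
  have : `|s * h z| <= 1 / 4.
    rewrite normrM gtr0_norm // mulrC ler_pdivrMr ?mulr_gt0 //.
    by apply: le_trans (hM z) _; lra.
  by rewrite ler_norml; lra.
apply/funext => z; rewrite -[LHS]/((s * h z + 1 / 2) * complex.Re (f z)).
by rewrite -[RHS]/(s * (h z * complex.Re (f z)) + 1 / 2 * complex.Re (f z)); ring.
Qed.

(** With [g = f - f x], apply [Choquet_multiplicative] with [h = Re g], then
    with [h = Im g] after replacing [g] by [- i g]. *)
Lemma Choquet_variance0 f : A f ->
  L (fun z => normc (f z - f x) ^+ 2) = 0.
Proof.
move=> Af0; pose g z := f z + - f x.
have Ag : A g by exact: ua_add_cst.
have gx : g x = 0 by rewrite /g subrr.
have bR := fun_bounded_Re cptX unifA Ag; have bI := fun_bounded_Im cptX unifA Ag.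
have Lsqr g' : A g' -> g' x = 0 ->
    L ((fun z => complex.Re (g' z)) * (fun z => complex.Re (g' z))) = 0.
  move=> Ag' g'x; rewrite Choquet_multiplicative //; last exact: (fun_bounded_Re cptX unifA).
  by rewrite g'x mulr0.
rewrite (_ : (fun _ => _) = (fun z => complex.Re (g z)) * (fun z => complex.Re (g z))
   + (fun z => complex.Im (g z)) * (fun z => complex.Im (g z))).
  rewrite (positive_functionalD posL); try exact: fun_boundedM.
  rewrite Lsqr // add0r -(Lsqr _ (ua_scale unifA (- 'i) Ag)) ?gx ?mulr0 //.
  by congr (L (_ * _)); apply/funext => z; rewrite Im_eq_Re.
by apply/funext => z; rewrite sqr_normcE -!expr2.
Qed.

(** Near [y] the indicator is at most a multiple of [|f - f x|^2], for any [f]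
    that separates [x] from [y]. *)
Lemma Choquet_null_nbhs y : x <> y ->
  exists2 N : set X, nbhs y N & L (\1_N) = 0.
Proof.
move=> /(ua_separates unifA)[f Af fxy]; have [_ Lmono _] := posL.
pose d := normc (f y - f x).
have d0 : 0 < d by apply: normc_gt0; rewrite subr_eq0; apply/eqP => /esym.
have d2 : 0 < d / 2 by rewrite divr_gt0.
have cfy : {for y, continuous f} by exact: (ua_continuous unifA Af).
have near_y := continuous_normc_near cfy d2.
exists [set z | normc (f z - f y) < d / 2] => //; set N := [set _ | _].
have bN : @fun_bounded R X (\1_N) by exact: fun_bounded_indic.
pose V z := normc (f z - f x) ^+ 2.
have bV : fun_bounded V.
  have [M M0 MP] := continuous_normc_bounded cptX
    (ua_continuous unifA (ua_add_cst unifA (- f x) Af)).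
  exists (M ^+ 2) => z; rewrite ger0_norm ?sqr_ge0 //.
  by rewrite lerXn2r ?nnegrE ?normc_ge0 ?(ltW M0).
apply: le_anti; apply/andP; split; last first.
  rewrite -(positive_functional0 posL); apply: Lmono => //.
  exact: fun_bounded_cst.
have -> : 0 = L (((d / 2) ^+ 2)^-1 *: V).
  by rewrite (positive_functionalZ posL) // Choquet_variance0 // mulr0.
apply: Lmono => // [|z]; first exact: fun_boundedZ.
rewrite -[leRHS]/(((d / 2) ^+ 2)^-1 * V z) mulrC ler_pdivlMr ?exprn_gt0 // indicE.
have [/set_mem Nz|_] := boolP (z \in N); last by rewrite mul0r sqr_ge0.
rewrite mul1r lerXn2r ?nnegrE ?normc_ge0 ?(ltW d2) //.
have := normc_add_le (f y - f z) (f z - f x).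
rewrite addrA subrK -/d normc_sub_sym; move: Nz; rewrite /N /=; lra.
Qed.

Lemma Choquet_null_off U : open U -> U x -> L (\1_(~` U)) = 0.
Proof.
move=> oU Ux; have [_ Lmono _] := posL.
have bi (N : set X) : @fun_bounded R X (\1_N) by exact: fun_bounded_indic.
have L_ge0 (N : set X) : 0 <= L (\1_N).
  rewrite -(positive_functional0 posL); apply: Lmono => //.
  exact: fun_bounded_cst.
apply: (@compact_ideal _ _ (fun N => L (\1_N) = 0)).
- by apply: subclosed_compact cptX _ => //; rewrite closedC.
- by rewrite indic0 (positive_functional0 posL).
- move=> N N' NN' LN'; apply: le_anti; rewrite L_ge0 andbT -LN'; apply: Lmono => // z.
  rewrite !indicE; have [/set_mem /NN' /mem_set ->|_] := boolP (z \in N).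
    exact: lexx.
  by rewrite ler0n.
- move=> N N' LN LN'; apply: le_anti; rewrite L_ge0 andbT.
  rewrite -[leRHS](addr0 0) -{1}LN -LN' -(positive_functionalD posL) //.
  apply: Lmono => // [|z]; first exact: fun_boundedD.
  rewrite addrfctE !indicE -natrD ler_nat in_setU.
  by case: (z \in N); case: (z \in N').
- by move=> y nUy; apply: Choquet_null_nbhs => xy; apply: nUy; rewrite -xy.
Qed.

End Representing.

(** The functional [L] that computes the infimum of [Re f x] over the majorants
    of the indicator of the complement of [U] vanishes on this indicator. *)
Lemma Choquet_peaking x U (e : R) : Choquet_boundary A x -> open U -> U x ->
  0 < e ->
  exists f, [/\ A f, complex.Re (f x) < e, forall z, 0 <= complex.Re (f z)
    & forall z, ~ U z -> 1 <= complex.Re (f z)].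
Proof.
move=> chx oU Ux e0.
have [L [posL LRe Lmaj]] := majorant_functional cptX unifA x (fun_bounded_indic R (~` U)).
have LU := Choquet_null_off chx posL LRe oU Ux.
have : ~ forall f, A f -> (forall z, \1_(~` U) z <= complex.Re (f z)) ->
    e <= complex.Re (f x).
  by move=> /Lmaj; rewrite LU leNgt e0.
move=> /existsNP[f] /not_implyP[Af] /not_implyP[fU] /negP; rewrite -ltNge => fe.
exists f; split=> // z; first by apply: le_trans (fU z); rewrite indicE ler0n.
by move=> nUz; have := fU z; rewrite indicE mem_set.
Qed.

(** If [Re f] is nonnegative, at least [1] off [U] and tiny at [x], then
    [w = 1 + C (f - i Im f x)] has modulus at least [1], at least [C + 1] off
    [U], and nearly [1] at [x], so [(1 + s) / w] peaks at [x]. *)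
Lemma Choquet_weak_peak_point x : hausdorff_space X ->
  Choquet_boundary A x -> weak_peak_set A [set x].
Proof.
move=> T2X chx; split; first exact/accessible_closed_set1/hausdorff_accessible.
move=> U e oU /(_ x erefl) Ux e0.
pose s := Num.min e 1; have s0 : 0 < s by rewrite lt_min e0 ltr01.
have se : s <= e by rewrite ge_min lexx.
have s1 : s <= 1 by rewrite ge_min lexx orbT.
pose C := 2 / e; have C0 : 0 < C by rewrite divr_gt0.
have [f [Af fx f0 fU]] := Choquet_peaking chx oU Ux (divr_gt0 s0 C0).
pose w z := C%:C * f z + (1 -i* (C * complex.Im (f x))).
have Aw : A w by apply: (ua_add_cst unifA); exact: ua_scale.
have wE z : complex.Re (w z) = C * complex.Re (f z) + 1.
  by rewrite /w; case: (f z) => p q /=; rewrite mul0r subr0.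
have invw : invertibles A w.
  apply: (invertible_Re_ge1 cptX unifA) => // z.
  by rewrite wE lerDr mulr_ge0 // ltW.
have w0 z : 0 < normc (w z) by apply: normc_gt0; exact: invertible_neq0 invw.
have w_ge z : C * complex.Re (f z) + 1 <= normc (w z) by rewrite -wE Re_le_normc.
have wx : normc (w x) <= 1 + s.
  have -> : w x = (C * complex.Re (f x) + 1)%:C.
    rewrite /w; case: (f x) => p q /=; apply/eqP; rewrite eq_complex /=.
    by rewrite mul0r subr0 mul0r addr0 subrr !eqxx.
  rewrite normc_real ger0_norm; last by rewrite addr_ge0 // mulr_ge0 // ltW.
  by move: fx; rewrite ltr_pdivlMr //; lra.
have kE z : normc ((1 + s)%:C * (w z)^-1) = (1 + s) / normc (w z).
  by rewrite normcM normcV normc_real ger0_norm //; lra.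
exists (fun z => (1 + s)%:C * (w z)^-1); split.
- apply: (invertible_scale unifA); last exact: invertible_inv.
  by apply/eqP => /(congr1 (@complex.Re R)) /=; lra.
- by move=> _ ->; rewrite kE ler_pdivlMr // mul1r.
- move=> z; rewrite kE ler_pdivrMr //; apply: (@le_trans _ _ (1 + e)); first by lra.
  rewrite ler_peMr ?addr_ge0 ?(ltW e0) //; apply: le_trans (w_ge z).
  by rewrite lerDr mulr_ge0 // ltW.
- move=> z nUz; rewrite kE ler_pdivrMr //; apply: (@le_trans _ _ (e * (C + 1))).
    by rewrite mulrDr mulr1 /C mulrCA divff ?gt_eqF //; lra.
  rewrite ler_pM2l //; apply: le_trans (w_ge z); rewrite lerD2r.
  by rewrite ler_peMr ?fU // ltW.
Qed.

End ChoquetPeakPoints.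

(** * Correspondences that preserve the norm of products *)

Section NormCorrespondences.
Variable R : realType.

(** A relation instead of a map: a surjection has no preferred inverse, but the
    converse of its graph has the same properties, so that each argument from
    [X] to [Y] also serves from [Y] to [X]. *)
Record norm_correspondence (X Y : topologicalType) (A : set (X -> R[i]))
    (B : set (Y -> R[i])) (C : (X -> R[i]) -> (Y -> R[i]) -> Prop) : Prop :=
  NormCorrespondence {
    nc_inv : forall f k, C f k -> invertibles A f /\ invertibles B k;
    nc_total : forall f, invertibles A f -> exists k, C f k;
    nc_onto : forall k, invertibles B k -> exists f, C f k;
    nc_norm : forall f g k l, C f k -> C g l ->
      supnorm [set: Y] (k * l) = supnorm [set: X] (f * g) }.

Lemma norm_correspondence_flip (X Y : topologicalType) (A : set (X -> R[i]))
    (B : set (Y -> R[i])) C :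
  norm_correspondence A B C -> norm_correspondence B A (fun k f => C f k).
Proof.
move=> [Cinv Ct Co Cn]; split=> //; first by move=> k f /Cinv[].
by move=> k l f g Cfk Cgl; rewrite (Cn f g k l).
Qed.

Section Partner.
Variables (X Y : topologicalType).
Variables (cptX : compact [set: X]) (cptY : compact [set: Y]).
Variables (A : set (X -> R[i])) (B : set (Y -> R[i])).
Variables (unifA : uniform_algebra A) (unifB : uniform_algebra B).
Variables (C : (X -> R[i]) -> (Y -> R[i]) -> Prop).
Hypothesis nc : norm_correspondence A B C.

Let continuous_inv (Z : topologicalType) (D : set (Z -> R[i])) f :
  uniform_algebra D -> invertibles D f -> continuous f.
Proof. by move=> unifD [Df _]; exact: ua_continuous unifD _ Df. Qed.

(** Choose [g] corresponding to [k^-1]: then [|l / k|] is bounded by the norm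
    of [h g], which is at most [c] times the norm of [f g], that is, of
    [k / k = 1]. *)
Lemma norm_correspondence_dominated f k h l (c : R) : C f k -> C h l -> 0 <= c ->
  (forall x, normc (h x) <= c * normc (f x)) ->
  forall y, normc (l y) <= c * normc (k y).
Proof.
move=> Cfk Chl c0 hf y; have [invf invk] := nc_inv nc Cfk.
have [invh invl] := nc_inv nc Chl.
have invV := invertible_inv invk; have [g Cg] := nc_onto nc invV.
have [invg _] := nc_inv nc Cg.
have ky : 0 < normc (k y) by apply: normc_gt0; exact: invertible_neq0 invk.
rewrite -ler_pdivrMr // -normcV -normcM.
apply: le_trans (normc_le_supnorm cptY y (continuous_inv unifB (invertible_mul unifB invl invV))) _.
rewrite (nc_norm nc Chl Cg); apply: supnorm_le => // x.
rewrite normcM; apply: le_trans (ler_wpM2r (normc_ge0 _) (hf x)) _.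
rewrite -mulrA -[leRHS]mulr1 ler_wpM2l // -normcM.
apply: le_trans (normc_le_supnorm cptX x (continuous_inv unifA (invertible_mul unifA invf invg))) _.
rewrite -(nc_norm nc Cfk Cg); apply: supnorm_le => // z.
by rewrite normcM normcV divff // gt_eqF // normc_gt0 // (invertible_neq0 z invk).
Qed.

(** The norm of [l * l] is that of [h * h]. *)
Lemma norm_correspondence_bounded h l (c : R) : C h l -> 0 <= c ->
  (forall x, normc (h x) <= c) -> forall y, normc (l y) <= c.
Proof.
move=> Chl c0 hc y; have [invh invl] := nc_inv nc Chl.
rewrite -(@ler_pXn2r _ 2) ?nnegrE ?normc_ge0 // expr2 -normcM.
apply: le_trans (normc_le_supnorm cptY y (continuous_inv unifB (invertible_mul unifB invl invl))) _.
rewrite (nc_norm nc Chl Chl); apply: supnorm_le => [|x]; first exact: sqr_ge0.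
by rewrite normcM expr2 ler_pM // normc_ge0.
Qed.

Definition partner_set x : set Y :=
  [set y | forall f k, C f k -> normc (f x) <= normc (k y)].

(** Functions peaking at [x] sharply enough correspond to functions bounded by
    one [q < 1] on [S]. As [q] does not depend on how sharply they peak, powers
    can be taken afterwards. *)
Definition uniform_gap x (S : set Y) :=
  exists2 q : R, 0 < q < 1 & exists W, exists2 e : R, 0 < e & [/\ open W, W x
    & forall h l, C h l -> (forall z, normc (h z) <= 1 + e) ->
        (forall z, ~ W z -> normc (h z) <= e) ->
        forall y, S y -> normc (l y) <= q].

(** The sets with a uniform gap form an ideal, so it is enough to look near a
    single [y] outside [partner_set x]. There [|k y| < |f x|] for some
    corresponding [f] and [k]; a function [h] that peaks at [x] is dominated by
    [|f| / (q |f x|)], and the function corresponding to [h] is then dominated by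
    [|k| / (q |f x|)], which is at most [q] near [y] if
    [|k y| / |f x| < q^2]. *)
Lemma partner_set_gap x U : open U -> partner_set x `<=` U ->
  uniform_gap x (~` U).
Proof.
move=> oU KU.
apply: (@compact_ideal _ _ (uniform_gap x)).
- by apply: subclosed_compact cptY _ => //; rewrite closedC.
- exists (1 / 2); first by lra.
  by exists setT, 1 => //; split=> //; exact: openT.
- move=> S S' SS' [q q01 [W [e e0 [oW Wx qP]]]]; exists q => //; exists W, e => //.
  by split=> // h l Chl h1 hW y /SS'; exact: qP Chl h1 hW y.
- move=> S S' [q q01 [W [e e0 [oW Wx qP]]]] [q' q01' [W' [e' e0' [oW' Wx' qP']]]].
  exists (Num.max q q'); first by rewrite lt_max gt_max; lra.
  exists (W `&` W'), (Num.min e e'); first by rewrite lt_min e0.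
  split=> //; first exact: openI.
  move=> h l Chl h1 hW y [Sy|S'y]; rewrite le_max; apply/orP; [left|right].
    apply: (qP h l Chl _ _ y Sy) => z.
      by apply: le_trans (h1 z) _; rewrite lerD2l ge_min lexx.
    by move=> nW; apply: (le_trans (hW z _)); [case | rewrite ge_min lexx].
  apply: (qP' h l Chl _ _ y S'y) => z.
    by apply: le_trans (h1 z) _; rewrite lerD2l ge_min lexx orbT.
  by move=> nW; apply: (le_trans (hW z _)); [case | rewrite ge_min lexx orbT].
move=> y nUy.
have [f [k [Cfk kf]]] : exists f k, C f k /\ normc (k y) < normc (f x).
  apply: contrapT => nfk; apply: nUy; apply: KU => f k Cfk.
  by rewrite leNgt; apply/negP => kf; apply: nfk; exists f, k.
have [invf invk] := nc_inv nc Cfk; have k0 := normc_ge0 (k y).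
set a := normc (f x) in kf; have a0 : 0 < a by exact: le_lt_trans k0 kf.
pose r := normc (k y) / a.
have r0 : 0 <= r by rewrite divr_ge0 // ltW.
have r1 : r < 1 by rewrite ltr_pdivrMr // mul1r.
(* [q^2 - r = ((1 - r) / 2)^2]. *)
pose q := (1 + r) / 2; have q0 : 0 < q by rewrite /q; lra.
have q1 : q < 1 by rewrite /q; lra.
have qr : r < q ^+ 2.
  have : 0 < (1 - r) ^+ 2 by rewrite exprn_gt0 // subr_gt0.
  by rewrite /q !expr2; lra.
exists [set y | normc (k y) < q ^+ 2 * a].
  apply: open_nbhs_nbhs; split; last by rewrite /= -ltr_pdivrMr.
  apply: (open_comp _ (@open_lt R (q ^+ 2 * a))) => z _.
  exact: continuous_normc (continuous_inv unifB invk) z.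
exists q; first by rewrite q0.
have [M M0 MP] := continuous_normc_bounded cptX (continuous_inv unifA (invertible_inv invf)).
(* The first bound serves near [x], where [|f| > (1 + q) |f x| / 2], and the
   second elsewhere, where only [|f| >= 1 / M] is known. *)
pose e := Num.min ((1 - q) / (2 * q)) (M * (q * a))^-1.
exists [set z | (1 + q) / 2 * a < normc (f z)], e.
  rewrite lt_min; apply/andP; split; last by rewrite invr_gt0 mulr_gt0 // mulr_gt0.
  by apply: divr_gt0; rewrite ?subr_gt0 // mulr_gt0.
split.
- apply: (open_comp _ (@open_gt R ((1 + q) / 2 * a))) => z _.
  exact: continuous_normc (continuous_inv unifA invf) z.
- by rewrite /= -/a gtr_pMl //; lra.
move=> h l Chl h1 hW z /= /ltW kz.
have c0 : 0 < (q * a)^-1 by rewrite invr_gt0 mulr_gt0.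
have -> : q = (q * a)^-1 * (q ^+ 2 * a) by field; rewrite !gt_eqF.
apply: le_trans (ler_wpM2l (ltW c0) kz).
apply: (norm_correspondence_dominated Cfk Chl (ltW c0)) => x'.
have [Wx'|nWx'] := pselect ((1 + q) / 2 * a < normc (f x')); last first.
  apply: (le_trans (hW _ nWx')); apply: (@le_trans _ _ (M * (q * a))^-1).
    by rewrite /e ge_min lexx orbT.
  rewrite invfM mulrC ler_wpM2l ?(ltW c0) //.
  have fx' := normc_gt0 (invertible_neq0 x' invf).
  by rewrite -[normc (f x')]invrK lef_pV2 ?posrE ?invr_gt0 // -normcV.
apply: (le_trans (h1 _)).
apply: (@le_trans _ _ ((q * a)^-1 * ((1 + q) / 2 * a))).
  apply: (@le_trans _ _ (1 + (1 - q) / (2 * q))).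
    by rewrite lerD2l /e ge_min lexx.
  rewrite le_eqVlt; apply/orP; left; apply/eqP; field.
  by rewrite !gt_eqF.
by rewrite ler_wpM2l ?(ltW c0) ?(ltW Wx').
Qed.

(** Functions corresponding to those that peak at [x] peak on [partner_set x],
    by definition of this set and by [partner_set_gap]. If the set were empty,
    such a function [l] would be at most [q < 1] everywhere, although [l * l] has
    the norm of [h * h], where [|h x| >= 1]. *)
Lemma partner_set_weak_peak x : weak_peak_set A [set x] ->
  weak_peak_set B (partner_set x) /\ partner_set x !=set0.
Proof.
move=> [_ wx].
have peak U : open U -> partner_set x `<=` U ->
    exists2 q : R, 0 < q < 1 & forall e : R, 0 < e ->
    exists h l, [/\ C h l, 1 <= normc (h x), forall y, normc (l y) <= 1 + e
      & forall y, ~ U y -> normc (l y) <= q].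
  move=> oU KU; have [q q01 [W [e0 e00 [oW Wx qP]]]] := partner_set_gap oU KU.
  exists q => // e' e'0.
  have m0 : 0 < Num.min e0 e' by rewrite lt_min e00.
  have [|h [invh h1 hm hW]] := wx W _ oW _ m0; first by move=> _ ->.
  have [l Chl] := nc_total nc invh; exists h, l; split=> //; first exact: h1.
    apply: (norm_correspondence_bounded Chl); first by rewrite addr_ge0 // ltW.
    by move=> z; apply: le_trans (hm z) _; rewrite lerD2l ge_min lexx orbT.
  apply: (qP h l Chl) => z.
    by apply: le_trans (hm z) _; rewrite lerD2l ge_min lexx.
  by move=> /hW /le_trans; apply; rewrite ge_min lexx.
split.
  apply: (weak_peak_set_gap unifB).
    rewrite (_ : partner_set x = \bigcap_(p in [set p | C p.1 p.2])
        [set y | normc (p.1 x) <= normc (p.2 y)]); last first.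
      by apply/seteqP; split=> y Ky; [move=> [f k]; exact: Ky | move=> f k /(Ky (f, k))].
    apply: closed_bigI => -[f k] /= /(nc_inv nc)[_ invk].
    apply: (closed_comp _ (@closed_ge R (normc (f x)))) => z _.
    exact: continuous_normc (continuous_inv unifB invk) z.
  move=> U oU KU; have [q q01 qP] := peak U oU KU; exists q => // e e0.
  have [h [l [Chl h1 le lq]]] := qP e e0; have [_ invl] := nc_inv nc Chl.
  by exists l; split=> // y Ky; apply: le_trans h1 (Ky _ _ Chl).
apply: contrapT => K0.
have [|q /andP[q0 q1] qP] := peak set0 open0 _.
  by move=> y Ky; apply: K0; exists y.
have [h [l [Chl h1 _ lq]]] := qP 1 ltr01.
have [invh _] := nc_inv nc Chl.
suff : 1 <= q ^+ 2 by rewrite leNgt exprn_ilt1 // ltW.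
apply: (@le_trans _ _ (normc ((h * h) x))).
  by rewrite normcM; nra.
apply: le_trans (normc_le_supnorm cptX x (continuous_inv unifA (invertible_mul unifA invh invh))) _.
rewrite -(nc_norm nc Chl Chl); apply: supnorm_le => [|y]; first exact: sqr_ge0.
by rewrite normcM expr2 ler_pM ?normc_ge0 // lq.
Qed.

Lemma weak_peak_point_partner x : weak_peak_set A [set x] ->
  exists2 y, weak_peak_set B [set y] &
    forall f k, C f k -> normc (f x) <= normc (k y).
Proof.
move=> /partner_set_weak_peak[wK K0].
by have [y Ky wy] := weak_peak_point_in cptY unifB wK K0; exists y.
Qed.

End Partner.
End NormCorrespondences.

(** * The homeomorphism of Choquet boundaries *)

Section ChoquetBoundary.
Variables (R : realType) (X : topologicalType).
Variables (cptX : compact [set: X]) (T2X : hausdorff_space X).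
Variables (A : set (X -> R[i])) (unifA : uniform_algebra A).

Lemma Choquet_boundaryE : Choquet_boundary A = [set x | weak_peak_set A [set x]].
Proof.
apply/seteqP; split=> x.
  exact: Choquet_weak_peak_point.
exact: weak_peak_point_Choquet.
Qed.

Lemma Choquet_eq_modulus x x' : Choquet_boundary A x ->
  (forall f, invertibles A f -> normc (f x) <= normc (f x')) -> x = x'.
Proof.
rewrite Choquet_boundaryE => wx le_f; apply: contrapT => xx'.
have [|f [invf fx fx']] := weak_peak_point_sep T2X wx xx' (e := 1 / 2) _.
  by rewrite divr_gt0.
have := le_f f invf; lra.
Qed.

Lemma weak_peak_setT : weak_peak_set A setT.
Proof.
split; first exact: closedT.
move=> U e _ TU e0; exists (fun _ => 1); split.
- exact/invertible_cst/oner_neq0.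
- by move=> x _; rewrite normc1.
- by move=> x; rewrite normc1 lerDl ltW.
- by move=> x nUx; case: nUx; exact: TU.
Qed.

End ChoquetBoundary.

Section PartnerMap.
Variables (R : realType) (X Y : topologicalType).
Variables (cptX : compact [set: X]) (T2X : hausdorff_space X).
Variables (cptY : compact [set: Y]) (T2Y : hausdorff_space Y).
Variables (A : set (X -> R[i])) (B : set (Y -> R[i])).
Variables (unifA : uniform_algebra A) (unifB : uniform_algebra B).
Variables (C : (X -> R[i]) -> (Y -> R[i]) -> Prop).
Hypothesis nc : norm_correspondence A B C.

(** Going to [Y] and back yields [|f x| <= |k y| <= |f x'|] for all
    corresponding [f] and [k], and then [x' = x] by [Choquet_eq_modulus]. *)
Lemma Choquet_partner x : Choquet_boundary A x ->
  exists2 y, Choquet_boundary B y & forall f k, C f k -> normc (k y) = normc (f x).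
Proof.
move=> chx; have wx : weak_peak_set A [set x] by move: chx; rewrite Choquet_boundaryE.
have [y wy fk] := weak_peak_point_partner cptX cptY unifA unifB nc wx.
have [x' _ kf] := weak_peak_point_partner cptY cptX unifB unifA
  (norm_correspondence_flip nc) wy.
have xx' : x = x'.
  apply: (Choquet_eq_modulus cptX T2X unifA chx) => f invf.
  have [k Cfk] := nc_total nc invf.
  exact: le_trans (fk f k Cfk) (kf k f Cfk).
exists y; first by rewrite Choquet_boundaryE.
by move=> f k Cfk; apply: le_anti; apply/andP; split; [rewrite xx'; exact: kf | exact: fk].
Qed.

Lemma partner_map : exists psi : X -> Y, forall x, Choquet_boundary A x ->
  Choquet_boundary B (psi x) /\ forall f k, C f k -> normc (k (psi x)) = normc (f x).
Proof.
suff /choice[psi psiP] : forall x, exists y, Choquet_boundary A x ->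
    Choquet_boundary B y /\ forall f k, C f k -> normc (k y) = normc (f x).
  by exists psi.
move=> x; have [x0 _ wx0] := weak_peak_point_in cptX unifA (weak_peak_setT unifA)
  (ex_intro _ x I).
have [y0 _ _] := weak_peak_point_partner cptX cptY unifA unifB nc wx0.
have [/Choquet_partner[y chy yE]|nchx] := pselect (Choquet_boundary A x).
  by exists y.
by exists y0.
Qed.

(** A function [k] that peaks at [psi x] confines [psi z] to a neighbourhood
    of [psi x] as soon as [|k (psi z)| > 1/2]; this modulus is [|f z|] for the
    corresponding [f], which is continuous. *)
Lemma partner_map_continuous (psi : X -> Y) :
  (forall x, Choquet_boundary A x -> Choquet_boundary B (psi x) /\
    forall f k, C f k -> normc (k (psi x)) = normc (f x)) ->
  {within Choquet_boundary A, continuous psi}.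
Proof.
move=> psiP; apply/subspace_continuousP => x chx P; rewrite nbhsE => -[U [oU Ux] UP].
have [] := psiP x chx; rewrite Choquet_boundaryE // => -[_ wpx] psix.
have [||k [invk k1 _ kU]] := wpx U (1 / 2) oU; first by move=> _ ->.
  by rewrite divr_gt0.
have [f Cfk] := nc_onto nc invk; have [[Af _] _] := nc_inv nc Cfk.
have cf : {for x, continuous f} by exact: (ua_continuous unifA Af).
have fx : 1 <= normc (f x) by rewrite -(psix f k Cfk) k1.
have half : 0 < (1 / 2 : R) by rewrite divr_gt0.
apply: filterS (continuous_normc_near cf half) => z fz chz.
apply: UP; apply: contrapT => /kU; have [_ /(_ f k Cfk) ->] := psiP z chz.
have := normc_sub_le (f x) (f z); rewrite normc_sub_sym; lra.
Qed.

End PartnerMap.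

Theorem theorem3p1 (R : realType) (X Y : topologicalType)
    (cptX : compact [set: X]) (T2X : hausdorff_space X)
    (cptY : compact [set: Y]) (T2Y : hausdorff_space Y)
    (A : set (X -> R[i])) (B : set (Y -> R[i]))
    (unifA : uniform_algebra A) (unifB : uniform_algebra B)
    (T : (X -> R[i]) -> (Y -> R[i]))
    (T_maps : set_fun (invertibles A) (invertibles B) T)
    (T_onto : set_surj (invertibles A) (invertibles B) T)
    (T_norm : forall f g, invertibles A f -> invertibles A g ->
      supnorm [set: Y] (T f * T g) = supnorm [set: X] (f * g)) :
  exists phi : Y -> X,
    homeomorphism_between (Choquet_boundary B) (Choquet_boundary A) phi /\
    forall f y, invertibles A f -> Choquet_boundary B y ->
      normc (T f y) = normc (f (phi y)).
Proof.
pose C f k := invertibles A f /\ T f = k.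
have nc : norm_correspondence A B C.
  split=> [f k [invf <-]|f invf|k /T_onto[f invf <-]|f g k l [invf <-] [invg <-]].
  - by split=> //; exact: T_maps.
  - by exists (T f).
  - by exists f.
  - exact: T_norm.
have cn := norm_correspondence_flip nc.
have [phi phiP] := partner_map cptY T2Y cptX T2X unifB unifA cn.
have [psi psiP] := partner_map cptX T2X cptY T2Y unifA unifB nc.
have phiK y : Choquet_boundary B y -> psi (phi y) = y.
  move=> chy; have [chx phiE] := phiP y chy; have [_ psiE] := psiP _ chx.
  apply/esym/(Choquet_eq_modulus cptY T2Y unifB chy) => k /(nc_onto nc)[f Cfk].
  by rewrite (psiE f k Cfk) (phiE k f Cfk).
have psiK x : Choquet_boundary A x -> phi (psi x) = x.
  move=> chx; have [chy psiE] := psiP x chx; have [_ phiE] := phiP _ chy.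
  apply/esym/(Choquet_eq_modulus cptX T2X unifA chx) => f /(nc_total nc)[k Cfk].
  by rewrite (phiE k f Cfk) (psiE f k Cfk).
exists phi; split; last first.
  by move=> f y invf chy; have [_ /(_ _ f (conj invf erefl)) ->] := phiP y chy.
split.
- split=> [y /phiP[]//|y y' /set_mem chy /set_mem chy' phi_eq|x chx].
    by rewrite -(phiK y) // phi_eq phiK.
  by exists (psi x); [have [] := psiP x chx | exact: psiK].
- exact: (partner_map_continuous cptX T2X unifB unifA cn phiP).
- exists psi; split; last by move=> y /set_mem; exact: phiK.
  exact: (partner_map_continuous cptY T2Y unifA unifB nc psiP).
Qed.
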